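(* Let $M\ge 2$ be an integer, let $p_{i,j}\in[0,1]$ for $i,j\in\{0,\dots,M-1\}$ with $\sum_{i,j=0}^{M-1}p_{i,j}>M$, and let $E\subset[0,1]^2$ be the associated fractal percolation. Assume that Condition A($\alpha$) holds for all $\alpha\in\mathfrak{D}=(0,\pi/2)\cup(\pi/2,\pi)$, and that $$\forall\, i,j\in\{0,\dots,M-1\}:\quad \sum_{l=0}^{M-1}p_{i,l}>1\quad\text{and}\quad\sum_{k=0}^{M-1}p_{k,j}>1.$$ Then, conditioned on $E\ne\emptyset$, almost surely the following holds: $\mathrm{proj}_\alpha(E)$ contains an interval for all $\alpha\in S^1$ simultaneously.
   Context: **Fractal percolation.** Let $K=[0,1]^2$. For $n\ge 0$ and $\underline{i}_n=(i_1,\dots,i_n),\ \underline{j}_n=(j_1,\dots,j_n)\in\{0,\dots,M-1\}^n$ let $K_{\underline{i}_n,\underline{j}_n}$ be the closed square of side $M^{-n}$ with lower left corner $\left(\sum_{l=1}^n i_lM^{-l},\sum_{l=1}^n j_lM^{-l}\right)$ (so $K_{\emptyset,\emptyset}=K$). Random families $\mathcal{E}_n$ of pairs $(\underline{i}_n,\underline{j}_n)$ are defined inductively: $\mathcal{E}_0=\{(\emptyset,\emptyset)\}$; if $(\underline{i}_n,\underline{j}_n)\notin\mathcal{E}_n$ then $(i_1,\dots,i_n,i;j_1,\dots,j_n,j)\notin\mathcal{E}_{n+1}$ for all $i,j$; if $(\underline{i}_n,\underline{j}_n)\in\mathcal{E}_n$ then $(i_1,\dots,i_n,i;j_1,\dots,j_n,j)\in\mathcal{E}_{n+1}$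 with probability $p_{i,j}$; all these events are jointly independent. Put $E_n=\bigcup_{(\underline{i}_n,\underline{j}_n)\in\mathcal{E}_n}K_{\underline{i}_n,\underline{j}_n}$ and $E=\bigcap_{n\ge1}E_n$. **Projections.** $\mathrm{proj}_\alpha$ is the orthogonal projection of $\mathbb{R}^2$ onto the line through the origin spanned by $(\cos\alpha,\sin\alpha)$ ($\alpha\in S^1=\mathbb{R}/2\pi\mathbb{Z}$); its fibres are the lines parallel to $(-\sin\alpha,\cos\alpha)$. ''Contains an interval'' means contains a non-degenerate open interval. For $\alpha\in(0,\pi/2)$ let $\Delta_\alpha$ be the diagonal of $K$ joining $(0,0)$ and $(1,1)$; for $\alpha\in(\pi/2,\pi)$ let $\Delta_\alpha$ be the diagonal joining $(0,1)$ and $(1,0)$. For $\alpha\in\mathfrak{D}$, $\Pi_\alpha:K\to\Delta_\alpha$ is the (generally non-orthogonal) linear projection onto $\Delta_\alpha$ along the fibres of $\mathrm{proj}_\alpha$. **The operator $F_\alpha$.** For $(i,j)\in\{0,\dots,M-1\}^2$ let $\varphi_{i,j}(x)=\frac1M x+\left(\frac iM,\frac jM\right)$, which maps $K$ onto $K_{i,j}$, and let $\psi_{\alpha,i,j}:\Pi_\alpha(K_{i,j})\to\Delta_\alpha$ be the inverse of the affine contraction $\Pi_\alpha\circ\varphi_{i,j}:\Delta_\alpha\to\Delta_\alpha$. For a function $f:\Delta_\alpha\to[0,\infty)$ vanishing at the endpoints of $\Delta_\alpha$ put $$F_\alpha f(x)=\sum_{(i,j):\,x\in\Pi_\alpha(K_{i,j})}p_{i,j}\,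 f(\psi_{\alpha,i,j}(x)),\qquad x\in\Delta_\alpha,$$ and let $F_\alpha^n$ be the $n$-th iterate of $F_\alpha$. **Condition A($\alpha$)** (for $\alpha\in\mathfrak{D}$). There exist non-degenerate closed intervals $I_1^\alpha,I_2^\alpha\subset\Delta_\alpha$ and a positive integer $r_\alpha$ such that $I_1^\alpha\subset\mathrm{int}\, I_2^\alpha$, $I_2^\alpha\subset\mathrm{int}\,\Delta_\alpha$ (interiors relative to the diagonal; $\mathrm{int}\,\Delta_\alpha$ is $\Delta_\alpha$ without its endpoints), and $F_\alpha^{r_\alpha}\mathbf{1}_{I_1^\alpha}\ge 2\cdot\mathbf{1}_{I_2^\alpha}$ pointwise on $\Delta_\alpha$. *)

(* Defs.v *)
From HB Require Import structures.
From mathcomp Require Import all_boot all_order all_algebra.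
From mathcomp Require Import all_classical all_reals all_analysis.
Set Implicit Arguments.
Unset Strict Implicit.
Unset Printing Implicit Defensive.
Import Order.TTheory GRing.Theory Num.Theory.
Import numFieldNormedType.Exports.
Local Open Scope classical_set_scope.
Local Open Scope ring_scope.

(* The pair of words (i_1 ... i_n, j_1 ... j_n) is encoded as the single word
   (i_1, j_1) ... (i_n, j_n), most significant digits first. *)
Definition word (M : nat) := seq ('I_M * 'I_M).

Definition corner (R : realType) (M : nat) (w : word M) : R * R :=
  (\sum_(l < size w) (tnth (in_tuple w) l).1%:R * M%:R ^- l.+1,
   \sum_(l < size w) (tnth (in_tuple w) l).2%:R * M%:R ^- l.+1).

Definition cell (R : realType) (M : nat) (w : word M) : set (R * R) :=
  [set z | (corner R w).1 <= z.1 <= (corner R w).1 + M%:R ^- size w /\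
           (corner R w).2 <= z.2 <= (corner R w).2 + M%:R ^- size w].

Arguments cell R {M} w _.

Definition mutually_independent d (T : measurableType d) (R : realType)
    (P : probability T R) (I : eqType) (A : I -> set T) : Prop :=
  forall s : seq I, uniq s ->
    P (\big[setI/setT]_(i <- s) A i) = (\prod_(i <- s) P (A i))%E.

(* [A (w, ij)] is the event that the child [rcons w ij] of [w] is kept as soon
   as [w] itself is. *)
Definition percolation_events d (T : measurableType d) (R : realType)
    (P : probability T R) (M : nat) (p : 'I_M -> 'I_M -> R)
    (A : word M * ('I_M * 'I_M) -> set T) : Prop :=
  [/\ forall x, measurable (A x),
      forall w i j, P (A (w, (i, j))) = (p i j)%:E &
      mutually_independent P A].

Fixpoint surviving (T : Type) (M : nat) (A : word M * ('I_M * 'I_M) -> set T)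
    (omega : T) (n : nat) : set (word M) :=
  if n is n'.+1 then
    [set v | exists w ij,
       [/\ surviving A omega n' w, A (w, ij) omega & v = rcons w ij]]
  else [set [::]].

Definition level_set (R : realType) (T : Type) (M : nat)
    (A : word M * ('I_M * 'I_M) -> set T) (omega : T) (n : nat) :
    set (R * R) :=
  \bigcup_(w in surviving A omega n) cell R w.

Arguments level_set R {T M} A omega n _.

Definition percolation_set (R : realType) (T : Type) (M : nat)
    (A : word M * ('I_M * 'I_M) -> set T) (omega : T) : set (R * R) :=
  \bigcap_(n in [set n | (1 <= n)%N]) level_set R A omega n.

Arguments percolation_set R {T M} A omega _.

Definition orth_proj (R : realType) (alpha : R) (z : R * R) : R * R :=
  let t := z.1 * cos alpha + z.2 * sin alpha in (t * cos alpha, t * sin alpha).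

(* For subsets of the line spanned by (cos alpha, sin alpha). *)
Definition contains_interval (R : realType) (alpha : R) (S : set (R * R)) :
    Prop :=
  exists a b : R, a < b /\
    [set (t * cos alpha, t * sin alpha) | t in `]a, b[] `<=` S.

Definition dirs (R : realType) : set R :=
  `]0, pi / 2[ `|` `]pi / 2, pi[.

Arguments dirs R _ : clear implicits.

(* Affine parametrization over [0, 1] of the diagonal attached to alpha;
   meaningful for alpha in [dirs R]. *)
Definition diag (R : realType) (alpha t : R) : R * R :=
  if alpha < pi / 2 then (t, t) else (t, 1 - t).

Definition Delta (R : realType) (alpha : R) : set (R * R) :=
  diag alpha @` `[0, 1].

(* The point of the diagonal on the line through z of direction
   (- sin alpha, cos alpha). *)
Definition Pi_diag (R : realType) (alpha : R) (z : R * R) : R * R :=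
  xget z [set u | Delta alpha u /\
    exists s : R, u = (z.1 - s * sin alpha, z.2 + s * cos alpha)].

Definition phi (R : realType) (M : nat) (i j : 'I_M) (z : R * R) : R * R :=
  (M%:R^-1 * z.1 + i%:R / M%:R, M%:R^-1 * z.2 + j%:R / M%:R).

Definition psi (R : realType) (M : nat) (alpha : R) (i j : 'I_M) :
    R * R -> R * R :=
  pinv_ id (Delta alpha) (Pi_diag alpha \o phi i j).

(* Only the values of f on [Delta alpha] enter in those of [F_op p alpha f] on
   [Delta alpha]. *)
Definition F_op (R : realType) (M : nat) (p : 'I_M -> 'I_M -> R) (alpha : R)
    (f : R * R -> R) (x : R * R) : R :=
  \sum_(ij : 'I_M * 'I_M | x \in Pi_diag alpha @` cell R [:: ij])
     p ij.1 ij.2 * f (psi alpha ij.1 ij.2 x).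

Definition condition_A (R : realType) (M : nat) (p : 'I_M -> 'I_M -> R)
    (alpha : R) : Prop :=
  exists (a1 b1 a2 b2 : R) (r : nat),
    let I1 := diag alpha @` `[a1, b1] in
    let I2 := diag alpha @` `[a2, b2] in
    [/\ a1 < b1, a2 < b2 & (0 < r)%N] /\
    [/\ I1 `<=` diag alpha @` `]a2, b2[,
        I2 `<=` diag alpha @` `]0, 1[ &
        forall x, Delta alpha x ->
          2 * \1_I2 x <= iter r (F_op p alpha) (\1_I1) x].

(* Main.v *)
(* A line of direction alpha is described by the point t where it crosses the
   diagonal and by a slope parameter lambda. Condition A says that through any
   t in I_2 the expected number of cells of generation r crossed by the line in
   their copy of I_1 is at least 2; as I_1 lies in the interior of I_2, this
   persists with a margin for all lambda in a neighbourhood and at all scales, so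
   that in generation n r only polynomially many (in M^n) lines have to be
   tested. By Chernoff's bound, the number of retained cells crossed by a test
   line grows by a factor > 1 from one generation to the next, except with a
   probability exp (- delta growth^n) that beats the number of tests. Hence, with
   positive probability, all the lines through I_1 with lambda in the
   neighbourhood meet every level set, and so meet E by compactness. If E is
   nonempty, the number of retained cells tends to infinity, and almost surely
   one of them roots a subtree for which this event holds. Countably many
   neighbourhoods cover the oblique directions. For the two axes, the columns (or
   rows) of cells serve as tests, and the hypotheses on the row and column sums
   replace Condition A. *)

Require Import Defs.
From HB Require Import structures.
From mathcomp Require Import all_boot all_order all_algebra.
From mathcomp Require Import all_classical all_reals all_analysis.
From mathcomp Require Import ring lra.
Set Implicit Arguments.
Unset Strict Implicit.
Unset Printing Implicit Defensive.
Import Order.TTheory GRing.Theory Num.Theory.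
Import numFieldNormedType.Exports.
Local Open Scope classical_set_scope.
Local Open Scope ring_scope.

(** * Independent Bernoulli variables *)

Section BernoulliExpectation.
Variables (R : realType) (I : eqType) (q : I -> R).

Definition upd (c : I -> bool) (x : I) (b : bool) : I -> bool :=
  fun y => if y == x then b else c y.

(* [Ex s F c] is the expectation of [F] when the coordinates listed in [s] are
   resampled as independent Bernoulli variables with parameters [q] and all the
   other coordinates are those of [c]. *)
Fixpoint Ex (s : seq I) (F : (I -> bool) -> R) (c : I -> bool) : R :=
  if s is x :: s' then
    q x * Ex s' F (upd c x true) + (1 - q x) * Ex s' F (upd c x false)
  else F c.

Definition indep_of (X : Type) (s : seq I) (F : (I -> bool) -> X) :=
  forall c x b, x \in s -> F (upd c x b) = F c.

Definition dep_on (X : Type) (s : seq I) (F : (I -> bool) -> X) :=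
  forall c c', {in s, c =1 c'} -> F c = F c'.

Lemma upd_comm c x y a b : x != y -> upd (upd c x a) y b = upd (upd c y b) x a.
Proof.
move=> xy; apply/funext => z; rewrite /upd.
by case: (eqVneq z y) => [->|//]; rewrite eq_sym (negbTE xy).
Qed.

Lemma upd_same c x a b : upd (upd c x a) x b = upd c x b.
Proof. by apply/funext => z; rewrite /upd; case: eqP. Qed.

Lemma dep_on_indep (X : Type) s t (F : (I -> bool) -> X) :
  dep_on s F -> (forall x, x \in t -> x \notin s) -> indep_of t F.
Proof.
move=> dF ts c x b xt; apply: dF => y ys; rewrite /upd.
by case: eqP ys => // ->; rewrite (negbTE (ts _ xt)).
Qed.

Lemma dep_on_sub (X : Type) s t (F : (I -> bool) -> X) :
  dep_on s F -> {subset s <= t} -> dep_on t F.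
Proof. by move=> dF st c c' cc'; apply: dF => x /st /cc'. Qed.

Lemma eq_Ex s F G c : (forall c, F c = G c) -> Ex s F c = Ex s G c.
Proof. by move=> FG; congr (Ex s _ c); apply/funext. Qed.

Lemma Ex_cat s t F : Ex (s ++ t) F = Ex s (Ex t F).
Proof. by apply/funext; elim: s => //= x s IH c; rewrite !IH. Qed.

Lemma ExD s F G c : Ex s (fun c => F c + G c) c = Ex s F c + Ex s G c.
Proof. by elim: s c => //= x s IH c; rewrite !IH; ring. Qed.

Lemma ExZ s a F c : Ex s (fun c => a * F c) c = a * Ex s F c.
Proof. by elim: s c => //= x s IH c; rewrite !IH; ring. Qed.

Lemma Ex_cst s a c : Ex s (fun=> a) c = a.
Proof. by elim: s c => //= x s IH c; rewrite !IH; ring. Qed.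

Lemma ExB s F G c : Ex s (fun c => F c - G c) c = Ex s F c - Ex s G c.
Proof.
rewrite (eq_Ex _ _ (G := fun c => F c + (-1) * G c)); last by move=> ?; ring.
by rewrite ExD ExZ; ring.
Qed.

Lemma Ex_sum s (J : Type) (r : seq J) (Q : pred J) (F : J -> (I -> bool) -> R) c :
  Ex s (fun c => \sum_(j <- r | Q j) F j c) c = \sum_(j <- r | Q j) Ex s (F j) c.
Proof.
elim: r => [|j r IH].
  by under eq_Ex do rewrite big_nil; rewrite Ex_cst big_nil.
rewrite big_cons -IH; case: (boolP (Q j)) => Qj.
  by rewrite -ExD; apply: eq_Ex => c'; rewrite big_cons Qj.
by apply: eq_Ex => c'; rewrite big_cons (negbTE Qj).
Qed.

Lemma Ex_indepM s F G c :
  indep_of s F -> Ex s (fun c => F c * G c) c = F c * Ex s G c.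
Proof.
elim: s c => //= x s IH c iF.
have iF' : indep_of s F by move=> ? y ? ys; apply: iF; rewrite inE ys orbT.
by rewrite !IH // !iF ?mem_head //; ring.
Qed.

Lemma Ex_indep_if s (Q : (I -> bool) -> bool) F G c : indep_of s Q ->
  Ex s (fun c => if Q c then F c else G c) c = if Q c then Ex s F c else Ex s G c.
Proof.
elim: s c => //= x s IH c iQ.
have iQ' : indep_of s Q by move=> ? y ? ys; apply: iQ; rewrite inE ys orbT.
by rewrite !IH // !iQ ?mem_head //; case: ifP.
Qed.

Lemma Ex_indep_upd s F c x b :
  (forall c b, F (upd c x b) = F c) -> Ex s F (upd c x b) = Ex s F c.
Proof.
move=> iF; elim: s c => //= y s IH c.
have [<-|yx] := eqVneq x y; first by rewrite !upd_same.
by rewrite !(upd_comm _ _ _ yx) !IH.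
Qed.

(** Independence in conditional form: the coordinates outside all the blocks stay frozen at [c], and
    a factor may depend on them. Later [c] carries the first generations and the blocks are the
    subtrees rooted at their ends. *)
Lemma Ex_flatten (J : eqType) (W : seq J) (B : J -> seq I)
    (f : J -> (I -> bool) -> R) c :
  uniq W -> {in W &, forall w w', w != w' -> indep_of (B w') (f w)} ->
  Ex (flatten [seq B w | w <- W]) (fun c => \prod_(w <- W) f w c) c =
  \prod_(w <- W) Ex (B w) (f w) c.
Proof.
elim: W c => [|w W IH] c /=; first by rewrite !big_nil.
move=> /andP[wW uW] iB; rewrite Ex_cat big_cons.
have iB' : {in W &, forall w w', w != w' -> indep_of (B w') (f w)}.
  by move=> u v uW' vW'; apply: iB; rewrite inE ?uW' ?vW' orbT.
have neq v : v \in W -> w != v by apply: contraTneq => <-.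
transitivity
  (Ex (B w) (fun c => (\prod_(v <- W) Ex (B v) (f v) c) * f w c) c).
  apply: eq_Ex => c1; under eq_Ex do rewrite big_cons.
  rewrite Ex_indepM ?IH // 1?mulrC // => c2 x b /flattenP[_ /mapP[v vW ->]] xBv.
  apply: (iB w v) => //; rewrite ?mem_head ?inE ?vW ?orbT //; exact: neq.
rewrite Ex_indepM 1?mulrC // => c1 x b xBw.
apply: eq_big_seq => v vW; apply: Ex_indep_upd => c2 b2.
by apply: (iB v w); rewrite ?mem_head ?inE ?vW ?orbT // eq_sym neq.
Qed.

(** Coordinates may be resampled in any order; if [x] occurs in [s] as well, the inner resampling
    overwrites the outer one. *)
Lemma Ex_swap1 x s F c :
  Ex (x :: s) F c = Ex s (Ex [:: x] F) c.
Proof.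
elim: s c => //= y s IH c.
have [<-|xy] := eqVneq x y.
  by have := IH; rewrite /= => IH'; rewrite -!IH' !upd_same.
by rewrite -!IH /= !(upd_comm _ _ _ xy); ring.
Qed.

Lemma Ex_swap s t F c : Ex s (Ex t F) c = Ex t (Ex s F) c.
Proof.
elim: s c => //= x s IH c; rewrite !IH.
rewrite -[LHS]/(Ex (x :: t) (Ex s F) c) Ex_swap1.
by [].
Qed.

Lemma Ex_perm s t F c : perm_eq s t -> Ex s F c = Ex t F c.
Proof.
move=> st; apply: (catCA_perm_ind _ st (P := fun s' => Ex s F c = Ex s' F c)) => //.
move=> s1 s2 s3 ->; rewrite !Ex_cat. exact: Ex_swap.
Qed.

Lemma Ex_eq_mem s t F c : uniq s -> uniq t -> s =i t -> Ex s F c = Ex t F c.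
Proof. by move=> us ut st; apply/Ex_perm/uniq_perm. Qed.

Lemma Ex_agree s F c c' :
  (forall d d' : I -> bool,
     (forall y, (y \in s) || (c y == c' y) -> d y = d' y) -> F d = F d') ->
  Ex s F c = Ex s F c'.
Proof.
elim: s c c' => [|x s IH] c c' dF /=; first by apply: dF => y /eqP.
suff dx b : Ex s F (upd c x b) = Ex s F (upd c' x b) by rewrite !dx.
apply: IH => d d' dd'; apply: dF => y; rewrite inE -orbA => yP; apply: dd'.
by move: yP; rewrite /upd; case: (y == x); rewrite //= eqxx orbT.
Qed.

Lemma Ex_dep s F c c' : dep_on s F -> Ex s F c = Ex s F c'.
Proof. by move=> dF; apply: Ex_agree => d d' dd'; apply: dF => y ys; rewrite dd' ?ys. Qed.

Lemma Ex_eq_dep s t F c : dep_on s F -> uniq s -> uniq t -> {subset s <= t} ->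
  Ex t F c = Ex s F c.
Proof.
move=> dF us ut st; pose u := [seq x <- t | x \notin s].
rewrite (@Ex_eq_mem _ (u ++ s)) //.
- rewrite Ex_cat -[RHS]mulr1 -(Ex_cst u 1 c) -Ex_indepM.
    by apply: eq_Ex => c'; rewrite mulr1.
  move=> c1 x b; rewrite mem_filter /= => /andP[xs _].
  apply: Ex_agree => d d' dd'; apply: dF => y ys; apply: dd'; by rewrite ys.
- rewrite cat_uniq filter_uniq // us andbT; apply/hasPn => x xs /=.
  by rewrite mem_filter /= xs.
- move=> x; rewrite mem_cat mem_filter /=; case: (boolP (x \in s)) => //= [/st ->//|_].
  by rewrite orbF.
Qed.

Hypothesis q01 : forall x, 0 <= q x <= 1.

Lemma Ex_le s F G c : (forall c, F c <= G c) -> Ex s F c <= Ex s G c.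
Proof.
move=> FG; elim: s c => //= x s IH c; have /andP[q0 q1] := q01 x.
by rewrite lerD // ler_wpM2l // subr_ge0.
Qed.

Lemma Ex_ge0 s F c : (forall c, 0 <= F c) -> 0 <= Ex s F c.
Proof. by move=> F0; rewrite -(Ex_cst s 0 c); exact: Ex_le. Qed.

(** The configuration [c] keeps exactly the coordinates of positive parameter. Restricted to a
    finite list it has positive probability, since a removed coordinate is removed with probability
    1. *)
Lemma Ex_gt0 s F c :
  (forall c, 0 <= F c) -> (forall x, c x = (0 < q x)) -> 0 < F c ->
  0 < Ex s F c.
Proof.
move=> F0 cq Fc; elim: s => //= x s IH; have /andP[q0 q1] := q01 x.
have uc : upd c x (c x) = c.
  by apply/funext => y; rewrite /upd; case: eqP => // ->.
have [qx|qx] := boolP (0 < q x).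
  rewrite -[true]qx -cq uc ltr_pwDl ?mulr_gt0 //.
  by rewrite mulr_ge0 ?subr_ge0 ?Ex_ge0.
have q0' : q x = 0 by apply/eqP; rewrite eq_le q0 andbT leNgt.
rewrite q0' mul0r add0r subr0 mul1r; move: uc; rewrite cq q0' ltxx => ->.
exact: IH.
Qed.

End BernoulliExpectation.

Lemma Ex_map (R : realType) (I J : eqType) (q : I -> R) (q' : J -> R)
    (h : J -> I) (s : seq J) (F : (J -> bool) -> R) c :
  injective h -> (forall x, q (h x) = q' x) ->
  Ex q (map h s) (fun c => F (c \o h)) c = Ex q' s F (c \o h).
Proof.
move=> hI qh; elim: s c => //= x s IH c; rewrite !IH qh.
suff uh b : upd c (h x) b \o h = upd (c \o h) x b by rewrite !uh.
by apply/funext => y; rewrite /upd /= (inj_eq hI).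
Qed.

Lemma Ex_upd (R : realType) (I : eqType) (q : I -> R) s F c x b : x \notin s ->
  Ex q s F (upd c x b) = Ex q s (fun c => F (upd c x b)) c.
Proof.
elim: s c => //= y s IH c; rewrite inE negb_or => /andP[xy xs].
by rewrite !(upd_comm _ _ _ xy) !IH.
Qed.

(** * From resampling expectations to probabilities of events *)

Definition config (T : Type) (I : eqType) (A : I -> set T) (omega : T) (x : I) :
  bool := `[< A x omega >].

Section ProbabilityOfFiniteEvents.
Variables (d : measure_display) (T : measurableType d) (R : realType).
Variables (P : probability T R) (I : eqType) (A : I -> set T) (q : I -> R).
Hypothesis mA : forall x, measurable (A x).
Hypothesis PA : forall x, P (A x) = (q x)%:E.
Hypothesis indepA : mutually_independent P A.

Lemma upd_config omega x : upd (config A omega) x (config A omega x) = config A omega.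
Proof. by apply/funext => y; rewrite /upd; case: eqP => // ->. Qed.

Lemma config_split x (Q : (I -> bool) -> bool) :
  [set omega | Q (config A omega)] =
  (A x `&` [set omega | Q (upd (config A omega) x true)]) `|`
  (~` A x `&` [set omega | Q (upd (config A omega) x false)]).
Proof.
apply/seteqP; split=> omega /=; have := upd_config omega x.
  by rewrite {2}/config; case: asboolP => Ax -> Qo; [left|right].
by rewrite {2}/config; case: asboolP => Ax E [] []; rewrite ?E.
Qed.

Lemma dep_on_upd s x (Q : (I -> bool) -> bool) b :
  dep_on (x :: s) Q -> dep_on s (fun c => Q (upd c x b)).
Proof.
move=> dQ c c' cc'; apply: dQ => y; rewrite inE /upd.
by case: eqP => //= _; exact: cc'.
Qed.

Lemma measurable_config s (Q : (I -> bool) -> bool) :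
  dep_on s Q -> measurable [set omega | Q (config A omega)].
Proof.
elim: s Q => [|x s IH] Q dQ.
  have QE c : Q c = Q (fun=> false) by exact: dQ.
  case Q0: (Q (fun=> false)).
    rewrite (_ : [set _ | _] = setT) //.
    by apply/seteqP; split => // omega _ /=; rewrite QE.
  rewrite (_ : [set _ | _] = set0) //.
  by apply/seteqP; split => // omega /=; rewrite QE Q0.
rewrite (config_split x); have IHb b := IH _ (dep_on_upd b dQ).
by apply: measurableU; apply: measurableI => //; exact: measurableC.
Qed.

(** [mutually_independent] speaks of intersections of the [A i], not of their complements. The extra
    list [t] lets the induction work: the part where [A x] fails is obtained by subtracting the
    formula for [x :: t] from the one for [t]. *)
Lemma prob_config_cap s t (Q : (I -> bool) -> bool) c :
  uniq (t ++ s) -> dep_on s Q ->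
  P ((\big[setI/setT]_(i <- t) A i) `&` [set omega | Q (config A omega)]) =
  ((\prod_(i <- t) q i) * Ex q s (fun c => (Q c)%:R) c)%:E.
Proof.
have mB t' : measurable (\big[setI/setT]_(i <- t') A i).
  by apply: big_ind => //; exact: measurableI.
elim: s t Q c => [|x s IH] t Q c.
  rewrite cats0 => ut dQ /=.
  have QE c' : Q c' = Q c by exact: dQ.
  case Qc: (Q c); last first.
    rewrite mulr0 (_ : _ `&` _ = set0) ?measure0 //.
    by apply/seteqP; split => // omega [_] /=; rewrite QE Qc.
  rewrite mulr1 (_ : [set _ | _] = setT); last first.
    by apply/seteqP; split => // omega _ /=; rewrite QE.
  rewrite setIT indepA //.
  elim: t {ut} => [|x t IHt]; first by rewrite !big_nil.
  by rewrite !big_cons IHt PA -EFinM.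
move=> uts dQ; have QE := config_split x Q; have dQ' b := dep_on_upd b dQ.
have xs : x \notin s by move: uts; rewrite cat_uniq /= => /and3P[_ _ /andP[]].
have uxts : uniq ((x :: t) ++ s).
  by rewrite -(perm_uniq (s1 := t ++ x :: s)) // -cat1s perm_catCA.
have uts' : uniq (t ++ s) by case/andP: uxts.
set B := \big[setI/setT]_(i <- t) A i.
pose Qb b := [set omega | Q (upd (config A omega) x b)].
have mQb b : measurable (Qb b) by apply: (measurable_config (dQ' b)).
have mQ := measurable_config dQ.
have IHb b t' : uniq (t' ++ s) ->
    P ((\big[setI/setT]_(i <- t') A i) `&` Qb b) =
    ((\prod_(i <- t') q i) * Ex q s (fun c => (Q (upd c x b))%:R) c)%:E.
  by move=> ut; exact: (IH t' _ c ut (dQ' b)).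
have E1 b : P (B `&` Qb b `&` A x) =
    ((\prod_(i <- t) q i) * q x * Ex q s (fun c => (Q c)%:R) (upd c x b))%:E.
  rewrite (_ : _ `&` _ = (\big[setI/setT]_(i <- x :: t) A i) `&` Qb b); last first.
    by rewrite big_cons [LHS]setIC setIA.
  by rewrite (IHb b (x :: t)) // big_cons Ex_upd // (mulrC (q x)).
have : P (B `&` Qb false) =
    (P (B `&` Qb false `\` A x) + P (B `&` Qb false `&` A x))%E.
  by apply: measureDI => //; apply: measurableI => //; exact: mB.
rewrite E1 (IHb false t) // => E2.
have -> : P (B `&` [set omega | Q (config A omega)]) =
    (P (B `&` [set omega | Q (config A omega)] `\` A x) +
     P (B `&` [set omega | Q (config A omega)] `&` A x))%E.
  by apply: measureDI => //; apply: measurableI => //; exact: mB.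
have -> : B `&` [set omega | Q (config A omega)] `\` A x = B `&` Qb false `\` A x.
  rewrite QE; apply/seteqP; split => omega /= [[Bo]].
    by move=> [[]|[]].
  by move=> Qo Ax; split=> //; split=> //; right.
have -> : B `&` [set omega | Q (config A omega)] `&` A x = B `&` Qb true `&` A x.
  rewrite QE; apply/seteqP; split => omega /= [[Bo]].
    by move=> [[]|[]].
  by move=> Qo Ax; split=> //; split=> //; left.
rewrite E1; move: E2; case: (P _) => [r|//|//]; rewrite -!EFinD => -[E2].
congr EFin; rewrite /= (mulrDr (\prod_(i <- t) q i)) -/(Ex _ _ _).
rewrite -[r](addrK (\prod_(i <- t) q i * q x *
  Ex q s (fun c => (Q c)%:R) (upd c x false))) -E2 Ex_upd //.
ring.
Qed.

Lemma prob_config s (Q : (I -> bool) -> bool) c : uniq s -> dep_on s Q ->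
  P [set omega | Q (config A omega)] = (Ex q s (fun c => (Q c)%:R) c)%:E.
Proof.
by move=> us dQ; have := @prob_config_cap s [::] Q c us dQ; rewrite !big_nil setTI mul1r.
Qed.

End ProbabilityOfFiniteEvents.

(** * The random tree *)

Section RandomTree.
Variables (R : realType) (D : finType) (p : D -> R).

(* The pair [(w, a)] stands for the edge from [w] to its child [rcons w a]. *)
Definition edge : eqType := (seq D * D)%type.

Definition bernoulli_param (x : edge) : R := p x.2.

Definition graft (w : seq D) (x : edge) : edge := (w ++ x.1, x.2).

Definition subtree (w : seq D) (c : edge -> bool) : edge -> bool :=
  c \o graft w.

Fixpoint alive (c : edge -> bool) (w : seq D) : bool :=
  if w is a :: w' then c ([::], a) && alive (subtree [:: a] c) w' else true.

Fixpoint words (k : nat) : seq (seq D) :=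
  if k is k'.+1 then [seq a :: w | a <- enum D, w <- words k'] else [:: [::]].

Fixpoint tree (k : nat) : seq edge :=
  if k is k'.+1 then
    flatten [seq ([::], a) :: map (graft [:: a]) (tree k') | a <- enum D]
  else [::].

Definition expect (k : nat) (F : (edge -> bool) -> R) : R :=
  Ex bernoulli_param (tree k) F (fun=> false).

Lemma graft_inj w : injective (graft w).
Proof. by move=> [u a] [v b] [] /eqP; rewrite eqseq_cat // eqxx /= => /eqP -> ->. Qed.

Lemma subtree0 c : subtree [::] c = c.
Proof. by apply/funext => -[]. Qed.

Lemma subtree_cat w v c : subtree (w ++ v) c = subtree v (subtree w c).
Proof. by apply/funext => x; rewrite /subtree /graft /= catA. Qed.

Lemma alive_cat c w v : alive c (w ++ v) = alive c w && alive (subtree w c) v.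
Proof.
elim: w c => [|a w IH] c /=; first by rewrite subtree0.
by rewrite IH -subtree_cat andbA.
Qed.

Lemma alive_rcons c w a : alive c (rcons w a) = alive c w && c (w, a).
Proof. by rewrite -cats1 alive_cat /= andbT /subtree /graft /= cats0. Qed.

Lemma mem_words k w : (w \in words k) = (size w == k).
Proof.
elim: k w => [|k IH] [|a w] //=; first by apply/allpairsP => -[[]] /= ? ? [].
rewrite eqSS -IH; apply/allpairsP/idP => [[[b v]] /= [_ vk [_ ->]]//|wk].
by exists (a, w); rewrite mem_enum.
Qed.

Lemma uniq_words k : uniq (words k).
Proof.
elim: k => //= k IH; apply: allpairs_uniq; rewrite ?enum_uniq //.
by move=> [a w] [b v] _ _ [-> ->].
Qed.

Lemma words_catE k r : words (k + r) =i [seq w ++ v | w <- words k, v <- words r].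
Proof.
move=> u; rewrite mem_words; apply/eqP/allpairsP => [su|[[w v]] /=].
  exists (take k u, drop k u); rewrite /= !mem_words size_takel ?su ?leq_addr //.
  by rewrite size_drop su addKn cat_take_drop.
by rewrite !mem_words => -[/eqP <- /eqP <- ->]; rewrite size_cat.
Qed.

Lemma perm_words_cat k r :
  perm_eq (words (k + r)) [seq w ++ v | w <- words k, v <- words r].
Proof.
apply: uniq_perm; rewrite ?uniq_words //; last exact: words_catE.
apply: allpairs_uniq; rewrite ?uniq_words // => -[w v] [w' v'].
move=> /allpairsP[[u t]] /= [uk _ [-> ->]] /allpairsP[[u' t']] /= [uk' _ [-> ->]] /=.
move: uk uk'; rewrite !mem_words => /eqP uk /eqP uk' /eqP.
by rewrite eqseq_cat ?uk ?uk' // => /andP[/eqP -> /eqP ->].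
Qed.

Lemma uniq_flatten_map (J I : eqType) (W : seq J) (B : J -> seq I) :
  uniq W -> {in W, forall w, uniq (B w)} ->
  (forall w w' x, w \in W -> w' \in W -> x \in B w -> x \in B w' -> w = w') ->
  uniq (flatten [seq B w | w <- W]).
Proof.
move=> uW uB disj.
rewrite (_ : flatten _ = [seq y | w <- W, y <- B w]); last first.
  by congr flatten; apply: eq_map => w; rewrite map_id.
apply: allpairs_uniq_dep => // -[w x] [w' x'] /=.
move=> /allpairsPdep[u [y [uW' yB e]]] /allpairsPdep[u' [y' [uW'' yB' e']]] xx'.
have [ew ex] : w = u /\ x = y by case: e.
have [ew' ex'] : w' = u' /\ x' = y' by case: e'.
move: xx' e e'; rewrite ew ex ew' ex' => yy' e e'.
rewrite -yy' in yB' *; congr (existT _ _ _); exact: disj yB yB'.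
Qed.

Lemma mem_tree k x : (x \in tree k) = (size x.1 < k)%N.
Proof.
elim: k x => [|k IH] [w a] //=; apply/flatten_mapP/idP => [[b _]|].
  rewrite inE => /orP[/eqP[-> //]|/mapP[[v a'] vt [-> _]]].
  by move: vt; rewrite IH.
case: w => [_|b w wk]; first by exists a; rewrite ?mem_enum ?mem_head.
exists b; first by rewrite mem_enum.
by rewrite inE; apply/orP; right; apply/mapP; exists (w, a); rewrite ?IH.
Qed.

Lemma uniq_tree k : uniq (tree k).
Proof.
elim: k => //= k IH; apply: uniq_flatten_map; first exact: enum_uniq.
  move=> a _ /=; rewrite map_inj_uniq ?IH; last exact: graft_inj.
  by rewrite andbT; apply/mapP => -[].
move=> a b [w e] _ _; rewrite !inE.
case/orP=> [/eqP[-> ->]|/mapP[[v e'] _ [-> _]]].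
  by case/orP=> [/eqP[] //|/mapP[[]]].
by case/orP=> [/eqP[] //|/mapP[[u ?] _ [->]]].
Qed.

Definition dep_tree (X : Type) k (F : (edge -> bool) -> X) := dep_on (tree k) F.

Lemma dep_treeW (X : Type) k l (F : (edge -> bool) -> X) :
  (k <= l)%N -> dep_tree k F -> dep_tree l F.
Proof.
move=> kl dF; apply: (dep_on_sub dF) => x; rewrite !mem_tree => xk.
exact: leq_trans kl.
Qed.

Lemma dep_subtree (X : Type) k w (F : (edge -> bool) -> X) :
  dep_tree k F -> dep_tree (size w + k) (F \o subtree w).
Proof.
move=> dF c c' cc'; apply: dF => x; rewrite mem_tree => xk.
by apply: cc'; rewrite mem_tree /= size_cat ltn_add2l.
Qed.

Lemma dep_alive k w : (size w <= k)%N -> dep_tree k (alive^~ w).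
Proof.
move=> wk; apply: (dep_treeW wk); elim: w {k wk} => [//|a w IH] c c' cc' /=.
rewrite cc' ?mem_tree //; congr (_ && _).
by apply: (dep_subtree (w := [:: a]) IH).
Qed.

Definition blocks k r := flatten [seq map (graft w) (tree r) | w <- words k].

Lemma blocks_uniq k r : uniq (blocks k r).
Proof.
apply: uniq_flatten_map; first exact: uniq_words.
  by move=> w _; rewrite map_inj_uniq ?uniq_tree //; exact: graft_inj.
move=> w w' x; rewrite !mem_words => /eqP wk /eqP wk'.
move=> /mapP[[v a] _ ->] /mapP[[v' a'] _ [/eqP]].
by rewrite eqseq_cat ?wk ?wk' // => /andP[/eqP].
Qed.

Lemma mem_blocks k r x : (x \in blocks k r) = (k <= size x.1 < k + r)%N.
Proof.
apply/flatten_mapP/idP => [[w]|/andP[kx xr]].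
  rewrite mem_words => /eqP <- /mapP[[v a]]; rewrite mem_tree /= => vr ->.
  by rewrite /= size_cat leq_addr ltn_add2l.
exists (take k x.1); first by rewrite mem_words size_takel.
apply/mapP; exists (drop k x.1, x.2); first by rewrite mem_tree size_drop ltn_subLR.
by case: x {kx xr} => w a; rewrite /graft /= cat_take_drop.
Qed.

(** Conditioning on the first [k] generations: [blocks k r] lists the edges of the next [r]
    generations, grouped by their ancestor of generation [k]. *)
Lemma expect_tower k r F :
  expect (k + r) F = expect k (Ex bernoulli_param (blocks k r) F).
Proof.
rewrite /expect -Ex_cat; apply: Ex_eq_mem; first exact: uniq_tree.
  rewrite cat_uniq uniq_tree blocks_uniq andbT /=; apply/hasPn => x.
  by rewrite mem_blocks /= mem_tree -leqNgt => /andP[].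
move=> x; rewrite mem_cat !mem_tree mem_blocks.
by case: (ltnP (size x.1) k) => //= xk; rewrite ltn_addr.
Qed.

Lemma Ex_graft r w (F : (edge -> bool) -> R) c : dep_tree r F ->
  Ex bernoulli_param (map (graft w) (tree r)) (F \o subtree w) c = expect r F.
Proof.
move=> dF.
rewrite (Ex_map (q' := bernoulli_param) _ _ _ (graft_inj (w := w))) //.
exact: Ex_dep.
Qed.

(** Branching at the root: the edges leaving the root and the subtrees behind them are independent.
    Each factor takes the state of its edge as a separate argument, so that its two cases can be
    weighted by [p a] and [1 - p a]. *)
Lemma expect_root k (f : D -> bool -> (edge -> bool) -> R) :
  (forall a b, dep_tree k (f a b)) ->
  expect k.+1 (fun c => \prod_a f a (c ([::], a)) (subtree [:: a] c)) =
  \prod_a (p a * expect k (f a true) + (1 - p a) * expect k (f a false)).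
Proof.
move=> df; rewrite {1}/expect /=.
under eq_Ex do rewrite -big_enum.
have ndisj a b : a != b -> forall x, x \in ([::], a) :: map (graft [:: a]) (tree k) ->
    x \notin ([::], b) :: map (graft [:: b]) (tree k).
  move=> ab [w e]; rewrite !inE; case/orP => [/eqP[-> ->]|/mapP[[v ?] _ [-> _]]].
    rewrite negb_or; apply/andP; split; first by apply: contra ab => /eqP[->].
    by apply/mapP => -[].
  rewrite negb_or; apply/andP; split=> //.
  by apply/mapP => -[[u ?] _ [/eqP]]; rewrite (negbTE ab).
rewrite Ex_flatten ?enum_uniq //; last first.
  move=> a b _ _ ab c x e xb.
  have ba : b != a by rewrite eq_sym.
  have /negbTE xa := ndisj b a ba x xb.
  have -> : upd c x e ([::], a) = c ([::], a).
    by rewrite /upd; case: eqP => // xE; rewrite -xE mem_head in xa.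
  apply: df => y yt; rewrite /subtree /= /upd; case: eqP => // yx.
  by move: xa; rewrite -yx inE map_f ?orbT.
rewrite [LHS]big_enum /=; apply: eq_bigr => a _ /=.
rewrite -(Ex_graft [:: a] (fun=> false) (df a true)).
rewrite -(Ex_graft [:: a] (fun=> false) (df a false)).
have na : ([::], a) \notin map (graft [:: a]) (tree k) by apply/mapP => -[].
rewrite !(Ex_upd _ _ _ _ na); congr (_ * _ + _ * _); apply: eq_Ex => c.
  by rewrite {1}/upd eqxx; congr (f _ _ _).
by rewrite {1}/upd eqxx; congr (f _ _ _).
Qed.

Lemma expect_alive k w : (size w <= k)%N ->
  expect k (fun c => (alive c w)%:R) = \prod_(a <- w) p a.
Proof.
elim: w k => [|a w IH] k /=.
  by rewrite /expect Ex_cst big_nil.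
case: k => // k wk; rewrite big_cons -(IH k) //.
pose f b e c : R := if b == a then (e && alive c w)%:R else 1.
transitivity (expect k.+1 (fun c => \prod_b f b (c ([::], b)) (subtree [:: b] c))).
  apply: eq_Ex => c; rewrite (bigD1 a) //= {1}/f eqxx big1 ?mulr1 // => b ba.
  by rewrite /f (negbTE ba).
rewrite expect_root; last first.
  move=> b e c c' cc'; rewrite /f; case: eqP => // _.
  by rewrite (dep_alive _ cc').
rewrite (bigD1 a) //= big1 ?mulr1; last first.
  by move=> b ba; rewrite /f (negbTE ba) /expect !Ex_cst; ring.
by rewrite /f eqxx /= [X in (1 - _) * X]Ex_cst mulr0 addr0.
Qed.

(** The probability generating function of the number of kept children. *)
Definition offspring_gf (s : R) : R := \prod_a (1 - p a + p a * s).

(** Vacuously true when generation [m] is empty; with [B] constantly false it expresses extinction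
    by generation [m]. *)
Fixpoint all_descendants (m : nat) (B : (edge -> bool) -> bool)
    (c : edge -> bool) : bool :=
  if m is m'.+1 then
    [forall a, c ([::], a) ==> all_descendants m' B (subtree [:: a] c)]
  else B c.

Lemma all_descendantsP m (B : (edge -> bool) -> bool) c :
  reflect (forall w, size w = m -> alive c w -> B (subtree w c))
          (all_descendants m B c).
Proof.
elim: m c => [|m IH] c /=.
  apply: (iffP idP) => [Bc w /size0nil -> _|/(_ [::] erefl erefl)];
  by rewrite subtree0.
apply: (iffP forallP) => [H [//|a w] [wm] /= /andP[ca aw]|H a].
  have /implyP/(_ ca)/IH/(_ w wm aw) := H a.
  by rewrite -subtree_cat.
apply/implyP => ca; apply/IH => w wm aw.
by rewrite -subtree_cat; apply: H => /=; rewrite ?wm ?ca.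
Qed.

Lemma dep_all_descendants m k (B : (edge -> bool) -> bool) :
  dep_tree k B -> dep_tree (m + k) (all_descendants m B).
Proof.
move=> dB; elim: m => [//|m IH] c c' cc' /=; apply: eq_forallb => a.
rewrite cc' ?mem_tree //; congr (_ ==> _).
by apply: (dep_subtree (w := [:: a]) IH).
Qed.

(** At the root, a child that is removed contributes 1 and a kept one the probability for its own
    subtree, so each generation applies the generating function once. *)
Lemma expect_all_descendants m k (B : (edge -> bool) -> bool) : dep_tree k B ->
  expect (m + k) (fun c => (all_descendants m B c)%:R) =
  iter m offspring_gf (expect k (fun c => (B c)%:R)).
Proof.
move=> dB; elim: m => [//|m IH]; rewrite addSn iterS -IH.
pose f (a : D) e c : R := (e ==> all_descendants m B c)%:R.
transitivity (expect (m + k).+1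
    (fun c => \prod_a f a (c ([::], a)) (subtree [:: a] c))).
  apply: eq_Ex => c; rewrite /f /=.
  case: forallP => H; first by rewrite big1 // => a _; rewrite H.
  have [a Ha] : exists a, ~~ (c ([::], a) ==> all_descendants m B (subtree [:: a] c)).
    by apply/existsP; rewrite -negb_forall; apply/negP => /forallP.
  by rewrite (bigD1 a) //= (negbTE Ha) mul0r.
rewrite expect_root.
  apply: eq_bigr => a _; rewrite /f /= [X in (1 - _) * X]Ex_cst mulr1 addrC.
  by congr (_ + _).
by move=> a e c c' cc'; rewrite /f (dep_all_descendants dB cc').
Qed.

End RandomTree.

(** * Survival and good subtrees *)

Section OffspringGeneratingFunction.
Variables (R : realType) (D : finType) (p : D -> R).
Hypothesis p01 : forall a, 0 <= p a <= 1.
Local Notation g := (offspring_gf p).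

Lemma gf_factor_ge0 a s : 0 <= s -> 0 <= 1 - p a + p a * s.
Proof. by move=> s0; have /andP[? ?] := p01 a; rewrite addr_ge0 ?subr_ge0 ?mulr_ge0. Qed.

Lemma gf_ge0 s : 0 <= s -> 0 <= g s.
Proof. by move=> s0; apply: prodr_ge0 => a _; exact: gf_factor_ge0. Qed.

Lemma gf_le s t : 0 <= s -> s <= t -> g s <= g t.
Proof.
move=> s0 st; apply: ler_prod => a _; rewrite gf_factor_ge0 //=.
by have /andP[? ?] := p01 a; rewrite lerD2l ler_wpM2l.
Qed.

(* Convexity, as a comparison of chord slopes cleared of denominators. *)
Lemma gf_convex z e b : 0 <= z -> z <= e -> e <= b ->
  (g e - g z) * (b - z) <= (g b - g z) * (e - z).
Proof.
move=> z0 ze eb; rewrite /offspring_gf; elim: (index_enum D) => [|a r IH].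
  by rewrite !big_nil !subrr !mul0r.
rewrite !big_cons; have /andP[p0 p1] := p01 a.
set x1 := \prod_(j <- r) _ in IH *; set x2 := \prod_(j <- r) _ in IH *.
set x3 := \prod_(j <- r) _ in IH *.
have e0 : 0 <= e by exact: le_trans ze.
have x12 : x1 <= x3.
  apply: ler_prod => i _; rewrite gf_factor_ge0 //=.
  by have /andP[? ?] := p01 i; rewrite lerD2l ler_wpM2l.
rewrite -subr_ge0.
have -> : ((1 - p a + p a * b) * x3 - (1 - p a + p a * z) * x2) * (e - z) -
    ((1 - p a + p a * e) * x1 - (1 - p a + p a * z) * x2) * (b - z) =
  (1 - p a + p a * z) * ((x3 - x2) * (e - z) - (x1 - x2) * (b - z)) +
  p a * (b - z) * (e - z) * (x3 - x1) by ring.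
rewrite addr_ge0 ?mulr_ge0 ?gf_factor_ge0 ?subr_ge0 //.
exact: le_trans eb.
Qed.

Hypothesis psum : 1 < \sum_a p a.

(** The slope of [g] at 1 is the mean offspring number [S > 1], so [g] is below the diagonal just
    left of 1. Quantitatively, [g (1 - eps)] is at most exp (- eps S), hence at most 1 / (1 + eps
    S), which is below [1 - eps] as soon as eps S < S - 1. *)
Lemma gf_below_diag b0 : b0 < 1 -> exists b, [/\ b0 <= b, 0 <= b, b < 1 & g b < b].
Proof.
move=> b01; pose S := \sum_a p a; have S1 : 1 < S by [].
pose eps := Num.min (1 - b0) (Num.min 1 ((S - 1) / (2 * S))).
have S0 : 0 < S by lra.
have eps0 : 0 < eps.
  by rewrite /eps !lt_min subr_gt0 b01 ltr01 divr_gt0 ?mulr_gt0 //; lra.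
have [e1 e2 e3] : [/\ eps <= 1 - b0, eps <= 1 & eps <= (S - 1) / (2 * S)].
  by split; rewrite /eps !ge_min lexx ?orbT.
exists (1 - eps); split; [lra|lra|lra|].
have : g (1 - eps) <= expR (- (eps * S)).
  rewrite -mulNr mulr_sumr expR_sum; apply: ler_prod => a _.
  have /andP[p0 p1] := p01 a; rewrite gf_factor_ge0 //=; last lra.
  by rewrite (_ : 1 - p a + _ = 1 + - eps * p a) ?expR_ge1Dx //; ring.
move=> /le_lt_trans; apply; rewrite expRN.
have h1 : 1 + eps * S <= expR (eps * S) by exact: expR_ge1Dx.
have h2 : 0 < 1 + eps * S by rewrite addr_gt0 ?mulr_gt0.
have h3 : (expR (eps * S))^-1 <= (1 + eps * S)^-1.
  by rewrite lef_pV2 // posrE ?expR_gt0.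
apply: (le_lt_trans h3); rewrite -[ltRHS]divr1 -[ltLHS]mul1r.
rewrite ltr_pdivrMr //; move: e3; rewrite ler_pdivlMr ?mulr_gt0 // => e3.
rewrite divr1.
have -> : (1 - eps) * (1 + eps * S) = 1 + eps * (S - 1 - eps * S) by ring.
rewrite ltrDl mulr_gt0 //; lra.
Qed.

(** Let [z] be the iterate of 0. By convexity, [g] expands distances from [z] below [b] by at most
    its chord slope between [z] and [b]. As [z <= g z] and [b - z <= 1], this slope is at most
    [1 - (b - g b)], so the two iterates approach each other geometrically. *)
Lemma iter_gf_close b0 : b0 < 1 -> exists2 rho : R, 0 <= rho < 1 &
  forall e m, 0 <= e <= b0 -> iter m g e - iter m g 0 <= rho ^+ m.
Proof.
move=> /gf_below_diag[b [b0b bge0 b1 gb]].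
have gbge0 : 0 <= g b by exact: gf_ge0.
exists (1 - (b - g b)) => [|e m /andP[e0 eb0]]; first by apply/andP; split; lra.
suff : [/\ 0 <= iter m g 0, iter m g 0 <= iter m g e, iter m g e <= b,
    iter m g 0 <= g (iter m g 0) & iter m g e - iter m g 0 <= (1 - (b - g b)) ^+ m].
  by case.
elim: m => [|m [z0 ze eb zg ez]] /=.
  by rewrite expr0; split=> //; [exact: le_trans b0b|exact: gf_ge0|lra].
set z := iter m g 0 in z0 ze zg ez *; set x := iter m g e in ze eb ez *.
have x0 : 0 <= x by exact: le_trans ze.
split; [exact: gf_ge0|exact: gf_le| |exact: gf_le|].
  by apply: le_trans (ltW gb); exact: gf_le.
rewrite exprS; apply: (@le_trans _ _ ((1 - (b - g b)) * (x - z))); last first.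
  by rewrite ler_wpM2l //; lra.
have [zb|zb] := leP b z.
  have -> : x = z by apply/eqP; rewrite eq_le ze (le_trans eb zb).
  by rewrite !subrr mulr0.
rewrite -(ler_pM2r (_ : 0 < b - z)) ?subr_gt0 //.
apply: (le_trans (gf_convex z0 ze eb)).
rewrite mulrAC ler_wpM2r ?subr_ge0 //.
have : 0 <= (b - g b) * (1 - (b - z)) by rewrite mulr_ge0 //; lra.
lra.
Qed.

End OffspringGeneratingFunction.

(** * Almost sure existence of a good subtree given survival *)

Section ZeroOne.
Variables (d : measure_display) (T : measurableType d) (R : realType).
Variables (P : probability T R) (D : finType) (p : D -> R).
Variable A : edge D -> set T.
Hypothesis p01 : forall a, 0 <= p a <= 1.
Hypothesis psum : 1 < \sum_a p a.
Hypothesis mA : forall x, measurable (A x).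
Hypothesis PA : forall x, P (A x) = (bernoulli_param p x)%:E.
Hypothesis indepA : mutually_independent P A.

Lemma prob_tree k (Q : (edge D -> bool) -> bool) : dep_tree k Q ->
  P [set omega | Q (config A omega)] = (expect p k (fun c => (Q c)%:R))%:E.
Proof. by move=> dQ; apply: prob_config => //; exact: uniq_tree. Qed.

Lemma measurable_tree k (Q : (edge D -> bool) -> bool) : dep_tree k Q ->
  measurable [set omega | Q (config A omega)].
Proof. exact: measurable_config. Qed.

Lemma bernoulli_param01 x : 0 <= bernoulli_param p x <= 1.
Proof. exact: p01. Qed.

(* [P (every node of generation m has a bad subtree, but some node exists)] is
   [iter m g b0 - iter m g 0] for the offspring generating function [g], which
   tends to 0 because [g] has no fixed point between the extinction probability
   and 1. *)
Lemma ae_good_subtree (B : nat -> (edge D -> bool) -> bool) (k : nat -> nat) (b0 : R) :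
  (forall n, dep_tree (k n) (B n)) -> (forall n c, B n c -> B n.+1 c) ->
  b0 < 1 -> (forall n, expect p (k n) (fun c => (B n c)%:R) <= b0) ->
  {ae P, forall omega,
    (forall n, exists2 w, size w = n & alive (config A omega) w) ->
    exists2 u, alive (config A omega) u &
      forall n, ~~ B n (subtree u (config A omega))}.
Proof.
move=> dB Bmono b01 EB.
have [rho /andP[rho0 rho1] rhoP] := iter_gf_close p01 psum b01.
have BmonoW n n' c : (n <= n')%N -> B n c -> B n' c.
  by move=> /subnK <-; elim: (n' - n)%N => // i IH Bn; rewrite addSn; exact/Bmono/IH.
pose Qb m n c := all_descendants m (B n) c && ~~ all_descendants m (fun=> false) c.
have dQ m n : dep_tree (m + k n) (Qb m n).
  move=> c c' cc'; rewrite /Qb; congr (_ && ~~ _).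
    exact: (dep_all_descendants (dB n)) cc'.
  by apply: (dep_all_descendants (k := k n) _ cc').
pose C m n := [set omega | Qb m n (config A omega)].
have PC m n : (P (C m n) <= (rho ^+ m)%:E)%E.
  rewrite (prob_tree (dQ m n)) lee_fin; apply: le_trans (rhoP _ m _); last first.
    apply/andP; split; last exact: (EB n).
    by apply: Ex_ge0 => [|c]; [exact: bernoulli_param01|rewrite ler0n].
  rewrite -(expect_all_descendants p m (dB n)).
  have -> : iter m (offspring_gf p) 0 =
      expect p (m + k n) (fun c => (all_descendants m (fun=> false) c)%:R).
    rewrite expect_all_descendants //; congr iter; by rewrite [RHS]Ex_cst.
  rewrite /expect -ExB; apply: Ex_le => [|c]; first exact: bernoulli_param01.
  rewrite /Qb; case: (all_descendantsP m (fun=> false)) => H; last by rewrite andbT subr0.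
  rewrite andbF; case: (all_descendantsP m (B n)) => H'; first by rewrite subrr.
  by exfalso; apply: H' => w wm /(H w wm).
have mC m n : measurable (C m n) by exact: measurable_tree (dQ m n).
pose V m := \bigcup_n C m n.
have mV m : measurable (V m) by exact: bigcup_measurable.
have PV m : (P (V m) <= (rho ^+ m)%:E)%E.
  have cv : P \o C m @ \oo --> P (V m).
    apply: nondecreasing_cvg_mu; [exact: mC|exact: mV|].
    move=> n n' nn'; apply/subsetPset => omega.
    rewrite /C /= /Qb => /andP[H ->]; rewrite andbT.
    apply/all_descendantsP => w wm aw; apply: (BmonoW n) => //.
    by move/all_descendantsP: H => /(_ w wm aw).
  rewrite -(cvg_lim _ cv) //; apply: lime_le; first by apply/cvg_ex; exists (P (V m)).
  by apply: nearW => n; exact: PC.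
(* The exceptional outcomes lie in every [V m], whose probability is at most [rho ^+ m]. *)
exists (\bigcap_m V m); split.
- exact: bigcap_measurable.
- apply/eqP; rewrite eq_le measure_ge0 andbT; apply/lee_addgt0Pr => e e0.
  have [m me] : exists m, rho ^+ m < e.
    have /cvgrPdist_lt/(_ _ e0)[m _ /(_ m (leqnn m))] :
        rho ^+ n @[n --> \oo] --> (0 : R) by apply: cvg_expr; rewrite ger0_norm.
    by rewrite sub0r normrN ger0_norm ?exprn_ge0 // => h; exists m.
  rewrite add0e; apply: (@le_trans _ _ (P (V m))).
    by apply: le_measure; rewrite ?inE //; [exact: bigcap_measurable|exact: bigcap_inf].
  by apply: (le_trans (PV m)); rewrite lee_fin ltW.
- move=> omega /= /not_implyP[surv /forall2NP bad] m _.
  have {}bad u : alive (config A omega) u -> exists n, B n (subtree u (config A omega)).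
    move=> au; have [//|/existsNP[n]] := bad u.
    by move=> /negP; rewrite negbK; exists n.
  have [f fP] : {f : seq D -> nat & forall u, alive (config A omega) u ->
      B (f u) (subtree u (config A omega))}.
    apply: (choice (P := fun u n =>
      alive (config A omega) u -> B n (subtree u (config A omega)))) => u.
    by have [/bad[n Bn]|nau] := boolP (alive (config A omega) u); [exists n|exists 0].
  (* Generation [m] is finite and [B] is monotone in its index, so one index serves for all its live
     words. *)
  exists (\max_(w <- words D m) f w) => //=; apply/andP; split.
    apply/all_descendantsP => w wm aw; apply: BmonoW (fP w aw).
    by apply: leq_bigmax_seq => //; rewrite mem_words wm.
  have [w wm aw] := surv m; apply/negP => /all_descendantsP/(_ w wm aw).
  by [].
Qed.

End ZeroOne.

(** * Large deviations along a family of tests *)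

Lemma expRN_le_quadratic (R : realType) (t : R) : 0 <= t ->
  expR (- t) <= 1 - t + t ^+ 2.
Proof.
move=> t0; rewrite expRN.
have t1 : 0 < 1 + t by lra.
apply: (@le_trans _ _ (1 + t)^-1).
  by rewrite lef_pV2 ?posrE ?expR_gt0 // expR_ge1Dx.
rewrite -[leLHS]mul1r ler_pdivrMr //.
have -> : (1 - t + t ^+ 2) * (1 + t) = 1 + t ^+ 3 by ring.
by rewrite lerDl exprn_ge0.
Qed.

(** This is [t / k <= expR (t / k)] raised to the power [k] and inverted. *)
Lemma expRN_le_power (R : realType) (k : nat) (t : R) : 0 < t -> (0 < k)%N ->
  expR (- t) <= (k%:R / t) ^+ k.
Proof.
move=> t0 k0; have k0' : 0 < k%:R :> R by rewrite ltr0n.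
have tk : 0 < t / k%:R by rewrite divr_gt0.
rewrite {1}(_ : t = k%:R * (t / k%:R)); last by rewrite mulrC divfK // gt_eqF.
rewrite expRN expRM_natl -exprVn; apply: lerXn2r; rewrite ?nnegrE.
- by rewrite invr_ge0 expR_ge0.
- by rewrite divr_ge0 ?ler0n // ltW.
- rewrite -(invf_div t) lef_pV2 ?posrE ?expR_gt0 //.
  by apply: le_trans (expR_ge1Dx _); rewrite lerDr.
Qed.

Lemma expr_gt_any (R : realType) (b x : R) : 1 < b -> exists k, x < b ^+ k.
Proof.
move=> b1; have h0 : 0 < b - 1 by lra.
have [k kx] : exists k : nat, x / (b - 1) < k%:R.
  exists (Num.truncn `|x / (b - 1)|).+1.
  by rewrite (le_lt_trans (ler_norm _)) // truncnS_gt.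
exists k; rewrite ltr_pdivrMr // in kx; apply: (lt_le_trans kx).
elim: k {kx} => [|k IH]; first by rewrite mul0r expr0.
have bk : 1 <= b ^+ k by apply: exprn_ege1; exact: ltW.
have -> : b ^+ k.+1 = b ^+ k + (b - 1) * b ^+ k by rewrite exprS; ring.
by rewrite -natr1 mulrDl mul1r lerD // ler_peMr // ltW.
Qed.

(** With [k] such that [2 * K <= growth ^+ k], the bound of [expRN_le_power] decays like the n-th
    power of [growth ^- k] and beats [K ^ n] by a factor 2^-n; [n0] then absorbs the constants. The
    bounds obtained have sum 1/2 over [j]. *)
Lemma superexponential_decay (R : realType) (delta growth : R) (C K : nat) :
  0 < delta -> 1 < growth -> exists n0 : nat, forall j,
  (C * K ^ (n0 + j).+1)%N%:R * expR (- (delta * growth ^+ (n0 + j))) <=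
  2^-1 ^+ (j + 2).
Proof.
move=> delta0 growth1; have growth0 : 0 < growth by lra.
have [k' k'P] := expr_gt_any (2 * K%:R) growth1.
pose k := k'.+1.
have kP : 2 * K%:R <= growth ^+ k.
  by apply: (le_trans (ltW k'P)); rewrite exprS ler_peMl ?exprn_ge0 // ltW.
pose A := (C * K)%:R * (k%:R / delta) ^+ k.
have A0 : 0 <= A by rewrite mulr_ge0 ?ler0n // exprn_ge0 // divr_ge0 ?ler0n // ltW.
have bound n : (C * K ^ n.+1)%N%:R * expR (- (delta * growth ^+ n)) <= A * 2^-1 ^+ n.
  have gn : 0 < growth ^+ n by rewrite exprn_gt0.
  have dn : 0 < delta * growth ^+ n by rewrite mulr_gt0.
  apply: (@le_trans _ _ ((C * K ^ n.+1)%N%:R * (k%:R / (delta * growth ^+ n)) ^+ k)).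
    by rewrite ler_wpM2l ?ler0n // expRN_le_power.
  have -> : (C * K ^ n.+1)%N%:R * (k%:R / (delta * growth ^+ n)) ^+ k =
      A * (K%:R / growth ^+ k) ^+ n.
    rewrite /A expnS mulnA !natrM natrX invfM !exprMn -!exprVn -!exprM (mulnC n).
    by ring.
  rewrite ler_wpM2l //; apply: lerXn2r; rewrite ?nnegrE.
  - by rewrite mulr_ge0 ?ler0n // invr_ge0 exprn_ge0 // ltW.
  - by rewrite invr_ge0 ler0n.
  - by rewrite ler_pdivrMr ?exprn_gt0 //; lra.
have [n0 n0P] : exists n0 : nat, 4 * A < n0%:R.
  exists (Num.truncn (4 * A)).+1; exact: truncnS_gt.
exists n0 => j; apply: (le_trans (bound _)).
rewrite exprD mulrA [leRHS]exprD [leRHS]mulrC.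
rewrite ler_wpM2r ?exprn_ge0 ?invr_ge0 ?ler0n //.
have : 4 * A < 2 ^+ n0 by apply: (lt_trans n0P); rewrite -natrX ltr_nat ltn_expl.
by rewrite exprVn => h; rewrite ler_pdivrMr ?exprn_gt0 //; lra.
Qed.

(* A test [x] of [X n] is a line known up to an error of order [M ^- (n * r)], and
   [S n x w] says that the cell [w], of generation [n * r], is crossed by it in
   its central part. *)
Section TestSystem.
Variables (R : realType) (D : finType) (p : D -> R).
Variables (tau : eqType) (X : nat -> seq tau) (S : nat -> tau -> seq D -> bool).
Variables (r C K : nat) (gamma growth : R).
Hypothesis p01 : forall a, 0 <= p a <= 1.
Hypothesis card_tests : forall n, (size (X n) <= C * K ^ n)%N.
Hypothesis test0 : forall x, x \in X 0 -> S 0 x [::].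
Hypothesis test_parent : forall n y, y \in X n.+1 -> exists2 x, x \in X n &
  forall w, size w = (n * r)%N -> S n x w ->
    gamma <= \sum_(v <- words D r | S n.+1 y (w ++ v)) \prod_(a <- v) p a.
Hypothesis growth1 : 1 < growth.
Hypothesis growth_gamma : growth < gamma.

Let q01 := bernoulli_param01 p01.
Let growth_ge0 : 0 <= growth := ltW (lt_trans ltr01 growth1).
Let gamma_ge0 : 0 <= gamma := le_trans growth_ge0 (ltW growth_gamma).

Definition hits n x (c : edge D -> bool) : R :=
  \sum_(w <- words D (n * r) | S n x w) (alive c w)%:R.

Definition offspring n y w (c : edge D -> bool) : R :=
  \sum_(v <- words D r | S n.+1 y (w ++ v)) (alive c v)%:R.

Lemma sum_words_cat n y (f : seq D -> R) :
  \sum_(w <- words D (n.+1 * r) | S n.+1 y w) f w =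
  \sum_(w <- words D (n * r)) \sum_(v <- words D r | S n.+1 y (w ++ v)) f (w ++ v).
Proof.
rewrite mulSnr (perm_big _ (perm_words_cat D (n * r) r)) /= big_mkcond big_allpairs_dep.
by apply: eq_bigr => w _; rewrite [RHS]big_mkcond.
Qed.

Lemma hits_succ n y c :
  hits n.+1 y c = \sum_(w <- words D (n * r)) (alive c w)%:R * offspring n y w (subtree w c).
Proof.
rewrite /hits sum_words_cat; apply: eq_bigr => w _.
by rewrite mulr_sumr; apply: eq_bigr => v _; rewrite alive_cat -natrM mulnb.
Qed.

Lemma dep_hits n x : dep_tree (n * r) (hits n x).
Proof.
move=> c c' cc'; rewrite /hits !(big_mkcond (S n x)); apply: eq_big_seq => w.
rewrite mem_words => /eqP wn; case: ifP => // _.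
by have := @dep_alive D (n * r) w; rewrite wn leqnn => /(_ erefl _ _ cc') ->.
Qed.

Lemma dep_offspring n y w : dep_tree r (offspring n y w).
Proof.
move=> c c' cc'; rewrite /offspring big_mkcond [RHS]big_mkcond.
apply: eq_big_seq => v; rewrite mem_words => /eqP vr; case: ifP => // _.
by have := @dep_alive D r v; rewrite vr leqnn => /(_ erefl _ _ cc') ->.
Qed.

Lemma offspring_ge0 n y w c : 0 <= offspring n y w c.
Proof. by apply: sumr_ge0 => v _; rewrite ler0n. Qed.

Lemma offspring_le n y w c : offspring n y w c <= (size (words D r))%:R.
Proof.
rewrite /offspring big_mkcond -sum1_size natr_sum /=.
by apply: ler_sum => v _; case: ifP => // _; rewrite ?ler0n // lern1 leq_b1.
Qed.

Lemma expect_offspring n y w : expect p r (offspring n y w) =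
  \sum_(v <- words D r | S n.+1 y (w ++ v)) \prod_(a <- v) p a.
Proof.
rewrite /expect Ex_sum big_mkcond [RHS]big_mkcond; apply: eq_big_seq => v.
rewrite mem_words => /eqP vr; case: ifP => // _.
by apply: expect_alive; rewrite vr.
Qed.

(** The offspring lies in [0, L], with [L] the number of words of length [r], so the quadratic bound
    on the exponential controls its Laplace transform by 1 - eps gamma + eps^2 L^2. Taking [eps]
    small against the gap between [gamma] and [growth] makes the quadratic term absorb at most half
    of the gain, uniformly in the test and the cell. *)
Lemma chernoff : exists eps delta : R, [/\ 0 < eps, 0 < delta &
  forall n y w, gamma <= expect p r (offspring n y w) ->
    expect p r (fun c => expR (- (eps * offspring n y w c))) <=
    expR (- (eps * growth + delta))].
Proof.
pose L : R := (size (words D r))%:R.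
pose h := gamma - growth.
have h0 : 0 < h by rewrite subr_gt0.
have L0 : 0 <= L by rewrite ler0n.
have L1 : 0 < L ^+ 2 + 1 by rewrite ltr_wpDl ?sqr_ge0.
pose eps := h / (2 * (L ^+ 2 + 1)).
have eps0 : 0 < eps by rewrite divr_gt0 // mulr_gt0.
have epsE : eps * (L ^+ 2 + 1) = h / 2 by rewrite /eps; field; rewrite gt_eqF.
exists eps, (eps * h / 2); split; [by []|by rewrite divr_gt0 // mulr_gt0|].
move=> n y w gE.
apply: (@le_trans _ _ (1 - eps * gamma + eps ^+ 2 * L ^+ 2)); last first.
  apply: (le_trans _ (expR_ge1Dx _)); rewrite -addrA lerD2l.
  have : 0 <= eps * (h / 2 - eps * L ^+ 2).
    by rewrite -epsE mulr_ge0 ?ltW //; lra.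
  by rewrite /h expr2; lra.
apply: (@le_trans _ _ (expect p r
    (fun c => 1 + (- eps) * offspring n y w c + eps ^+ 2 * L ^+ 2))).
  apply: Ex_le => [|c]; first exact: q01.
  have o0 := offspring_ge0 n y w c; have oL := offspring_le n y w c.
  have := expRN_le_quadratic (mulr_ge0 (ltW eps0) o0).
  move=> /le_trans; apply; rewrite mulNr lerD2l exprMn ler_wpM2l ?sqr_ge0 //.
  by apply: lerXn2r; rewrite ?nnegrE.
rewrite /expect !ExD (ExZ _ _ (- eps)) !Ex_cst.
rewrite lerD2r mulNr lerD2l lerN2 ler_wpM2l //; exact: ltW.
Qed.

Definition passes n (c : edge D -> bool) : bool :=
  all (fun x => growth ^+ n <= hits n x c) (X n).

Lemma dep_passes n : dep_tree (n * r) (passes n).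
Proof. by move=> c c' cc'; apply: eq_all => x; rewrite (dep_hits x cc'). Qed.

(** The window starts at [n0] because the union bound over the tests is effective only from some
    generation on. *)
Fixpoint passes_upto n0 m (c : edge D -> bool) : bool :=
  if m is m'.+1 then passes_upto n0 m' c && passes (n0 + m) c else passes n0 c.

Lemma passes_uptoW n0 m c : passes_upto n0 m c -> passes (n0 + m) c.
Proof. by case: m => [|m] /=; rewrite ?addn0 // => /andP[]. Qed.

Lemma dep_passes_upto n0 m : dep_tree ((n0 + m) * r) (passes_upto n0 m).
Proof.
elim: m => [|m IH] c c' cc' /=; first by rewrite addn0 in cc'; exact: dep_passes cc'.
rewrite (dep_passes cc'); congr (_ && _).
by apply: (dep_treeW _ IH) cc'; rewrite leq_mul2r leq_add2l leqnSn orbT.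
Qed.

(** Where [G] is nonzero, the parent test has at least [growth ^+ n] hits. Given the first [n * r]
    generations, these cells have independent offspring, so Markov's inequality for the exponential
    of [- eps * hits] multiplies their Laplace transforms. The resulting exponent is at most eps
    growth^(n+1) - (eps growth + delta) growth^n = - delta growth^n. *)
Lemma hits_unlikely_small eps delta n y (G : (edge D -> bool) -> R) :
  (forall n y w, gamma <= expect p r (offspring n y w) ->
    expect p r (fun c => expR (- (eps * offspring n y w c))) <=
    expR (- (eps * growth + delta))) ->
  0 < eps -> 0 < delta -> y \in X n.+1 -> dep_tree (n * r) G ->
  (forall c, 0 <= G c) -> (forall c, G c != 0 -> passes n c) ->
  expect p (n.+1 * r) (fun c => G c * (hits n.+1 y c < growth ^+ n.+1)%R%:R) <=
  expect p (n * r) G * expR (- (delta * growth ^+ n)).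
Proof.
move=> chern eps0 delta0 yX dG G0 Gpass.
have [x xX Hx] := test_parent yX.
rewrite mulSnr expect_tower mulrC -ExZ /expect; apply: Ex_le => [|c]; first exact: q01.
rewrite Ex_indepM; last first.
  apply: dep_on_indep dG _ => z; rewrite mem_blocks mem_tree => /andP[nz _].
  by rewrite -leqNgt.
rewrite mulrC; have [->|Gc] := eqVneq (G c) 0; first by rewrite !mulr0.
rewrite ler_wpM2r //.
have cx : growth ^+ n <= hits n x c by apply: (allP (Gpass _ Gc)).
(* Only the live cells crossed by the parent test keep their factor; the factor of any other cell is
   bounded by 1, as the offspring is nonnegative. *)
pose f w (c : edge D -> bool) : R := if alive c w && S n x w
  then expR (- (eps * offspring n y w (subtree w c))) else 1.
apply: (@le_trans _ _ (Ex (bernoulli_param p) (blocks D (n * r) r)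
    (fun c => expR (eps * growth ^+ n.+1) * \prod_(w <- words D (n * r)) f w c) c)).
  apply: Ex_le => [|c']; first exact: q01.
  case: ltP => [small|_]; last first.
    rewrite mulr_ge0 ?expR_ge0 // prodr_ge0 // => w _; rewrite /f.
    by case: ifP => // _; rewrite expR_ge0.
  apply: (@le_trans _ _ (expR (eps * growth ^+ n.+1) * expR (- (eps * hits n.+1 y c')))).
    rewrite -expRD -[leLHS]expR0 ler_expR subr_ge0 ler_pM2l //; exact: ltW.
  rewrite ler_wpM2l ?expR_ge0 // hits_succ mulr_sumr -sumrN expR_sum.
  apply: ler_prod => w _; rewrite expR_ge0 /f /=.
  case: (alive c' w) => /=; last by rewrite mul0r mulr0 oppr0 expR0.
  case: (S n x w); first by rewrite mul1r.
  rewrite mul1r -[leRHS]expR0 ler_expR oppr_le0 mulr_ge0 ?offspring_ge0 //.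
  exact: ltW.
rewrite ExZ /blocks Ex_flatten ?uniq_words //; last first.
  move=> w w'; rewrite !mem_words => /eqP wn /eqP wn' ww' c1 z b zw'.
  have nzw : z \notin map (graft w) (tree D r).
    move: zw' => /mapP[[v a] _ ->]; apply/mapP => -[[v' a'] _ [/eqP]].
    by rewrite eqseq_cat ?wn ?wn' // eq_sym (negbTE ww').
  have nz : z \notin tree D (n * r).
    by move: zw' => /mapP[[v a] _ ->]; rewrite mem_tree /= size_cat wn' -leqNgt leq_addr.
  rewrite /f; have -> : alive (upd c1 z b) w = alive c1 w.
    apply: (dep_alive (k := n * r)); first by rewrite wn.
    by move=> t tt; rewrite /upd; case: eqP => // tz; rewrite -tz tt in nz.
  case: ifP => // _; congr (expR (- (eps * _))).
  apply: dep_offspring => t tt; rewrite /subtree /= /upd; case: eqP => // tz.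
  by rewrite -tz map_f in nzw.
have fE w : w \in words D (n * r) ->
    Ex (bernoulli_param p) (map (graft w) (tree D r)) (f w) c <=
    expR (- ((eps * growth + delta) * (if S n x w then (alive c w)%:R else 0))).
  rewrite mem_words => /eqP wn; rewrite /f Ex_indep_if; last first.
    move=> c1 z b zw; congr (_ && _); apply: (dep_alive (k := n * r)); first by rewrite wn.
    move=> t; rewrite mem_tree => tn; rewrite /upd; case: eqP => // tz.
    by move: zw tn => /mapP[[v a] _]; rewrite tz => -> /=; rewrite size_cat wn ltnNge leq_addr.
  case Sw: (S n x w); last first.
    by rewrite andbF Ex_cst mulr0 oppr0 expR0.
  rewrite andbT; case: (alive c w); last by rewrite Ex_cst mulr0 oppr0 expR0.
  rewrite mulr1 (Ex_graft p w (F := fun c => expR (- (eps * offspring n y w c))) c).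
    by apply: chern; rewrite expect_offspring; exact: Hx.
  by move=> c1 c2 c12; rewrite (dep_offspring n y w c12).
apply: (@le_trans _ _ (expR (eps * growth ^+ n.+1) *
    expR (- ((eps * growth + delta) * hits n x c)))).
  rewrite ler_wpM2l ?expR_ge0 // /hits mulr_sumr -sumrN (big_mkcond (S n x)) expR_sum.
  rewrite big_seq [leRHS]big_seq; apply: ler_prod => w wn; apply/andP; split.
    by apply: Ex_ge0 => [|c']; [exact: q01|rewrite /f; case: ifP => // _; rewrite expR_ge0].
  apply: (le_trans (fE w wn)); case: ifP => //.
  by rewrite mulr0 oppr0.
rewrite -expRD ler_expR exprS.
have gn : 0 <= hits n x c - growth ^+ n by rewrite subr_ge0.
have : 0 <= (eps * growth + delta) * (hits n x c - growth ^+ n).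
  by rewrite mulr_ge0 // addr_ge0 ?mulr_ge0 // ltW.
lra.
Qed.

(* The kept edges are not random here, so the number of hits is at least its
   expectation, which exceeds [gamma ^+ n]. *)
Lemma passes_positive_edges n (c : edge D -> bool) :
  (forall x, c x = (0 < bernoulli_param p x)) -> passes n c.
Proof.
move=> cp; apply/allP => x xX.
have prod01 w : 0 <= \prod_(a <- w) p a <= 1.
  elim: w => [|a w /andP[w0 w1]]; first by rewrite big_nil ler01 lexx.
  have /andP[a0 a1] := p01 a.
  by rewrite big_cons mulr_ge0 //= mulr_ile1.
have alive_ge w c' : (forall x, c' x = (0 < bernoulli_param p x)) ->
    \prod_(a <- w) p a <= (alive c' w)%:R.
  elim: w c' => [|a w IH] c' c'p /=; first by rewrite big_nil.
  have /andP[a0 a1] := p01 a; have /andP[w0 w1] := prod01 w.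
  rewrite big_cons c'p /bernoulli_param /=; case: (ltP 0 (p a)) => pa /=.
    apply: le_trans (IH (subtree [:: a] c') _); last by move=> z; rewrite /subtree /= c'p.
    by rewrite ler_piMl.
  have -> : p a = 0 by apply/eqP; rewrite eq_le pa a0.
  by rewrite mul0r.
apply: (@le_trans _ _ (\sum_(w <- words D (n * r) | S n x w) \prod_(a <- w) p a)); last first.
  by apply: ler_sum => w _; exact: alive_ge.
elim: n x xX => [|n IH] x xX.
  by rewrite mul0n /= big_cons big_nil test0 // big_nil addr0 expr0.
have [x' x'X Hx'] := test_parent xX.
rewrite sum_words_cat exprS.
apply: (@le_trans _ _ (\sum_(w <- words D (n * r) | S n x' w) gamma * \prod_(a <- w) p a)).
  by rewrite -mulr_sumr ler_pM ?exprn_ge0 ?IH // ltW.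
rewrite big_mkcond /= big_seq [leRHS]big_seq; apply: ler_sum => w.
rewrite mem_words => /eqP wn.
under [leRHS]eq_bigr do rewrite big_cat /=; rewrite -mulr_sumr.
have /andP[w0 _] := prod01 w.
case: ifP => Sw; first by rewrite mulrC ler_wpM2l // Hx'.
by rewrite mulr_ge0 // sumr_ge0 // => v _; have /andP[] := prod01 v.
Qed.

(** Passing at [n0] has positive probability by [passes_positive_edges] and [Ex_gt0]; later
    generations cost factors whose product stays away from 0. *)
Lemma passes_likely : exists n0 (a : R), 0 < a /\
  forall m, a <= expect p ((n0 + m) * r) (fun c => (passes_upto n0 m c)%:R).
Proof.
have [eps [delta [eps0 delta0 chern]]] := chernoff.
have [n0 n0P] := @superexponential_decay R delta growth C K delta0 growth1.
pose a := expect p (n0 * r) (fun c => (passes n0 c)%:R).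
have a0 : 0 < a.
  pose c1 x := 0 < bernoulli_param p x.
  rewrite /a /expect (Ex_dep _ _ c1).
    apply: (Ex_gt0 q01) => [c|//|]; first exact: ler0n.
    by rewrite passes_positive_edges.
  by move=> c c' cc'; rewrite (dep_passes cc').
exists n0, (a / 2); split; first by rewrite divr_gt0.
(* These bounds start at [a] and decrease to [a / 2], slowly enough that step [m] may lose a factor
   1 - 2^-(m+2). *)
suff main m : a * (2^-1 + 2^-1 ^+ m.+1) <=
    expect p ((n0 + m) * r) (fun c => (passes_upto n0 m c)%:R).
  by move=> m; apply: le_trans (main m); rewrite ler_wpM2l ?ltW // ltrDl exprn_gt0 // invr_gt0.
elim: m => [|m IH].
  by rewrite addn0 /= -/a expr1; lra.
pose E := expect p ((n0 + m) * r) (fun c => (passes_upto n0 m c)%:R).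
apply: (@le_trans _ _ (E * (1 - 2^-1 ^+ (m + 2)))).
  set h : R := 2^-1 ^+ m.+1 in IH *.
  have h0 : 0 < h by rewrite exprn_gt0 // invr_gt0.
  have h1 : h <= 2^-1 by rewrite /h exprS ler_piMr // exprn_ile1 // ?invr_ge0 // invf_le1 // ler1n.
  have hE : 2^-1 ^+ (m + 2) = h / 2 by rewrite addn2 exprS mulrC.
  have hE' : 2^-1 ^+ m.+2 = h / 2 by rewrite exprS mulrC.
  rewrite hE hE'; apply: (@le_trans _ _ (a * (2^-1 + h) * (1 - h / 2))).
    rewrite -mulrA ler_wpM2l //; first exact: ltW.
    have : 0 <= h * (2^-1 - h) by rewrite mulr_ge0 ?subr_ge0 // ltW.
    by lra.
  by rewrite ler_wpM2r //; lra.
pose G c : R := (passes_upto n0 m c)%:R.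
have GE : E = expect p ((n0 + m).+1 * r) G.
  rewrite /E /expect; symmetry; apply: Ex_eq_dep; rewrite ?uniq_tree //.
    by move=> c c' cc'; rewrite /G (dep_passes_upto cc').
  move=> z; rewrite !mem_tree => /leq_trans; apply.
  by rewrite leq_mul2r leqnSn orbT.
have small y : y \in X (n0 + m).+1 ->
    expect p ((n0 + m).+1 * r)
      (fun c => G c * (hits (n0 + m).+1 y c < growth ^+ (n0 + m).+1)%R%:R) <=
    E * expR (- (delta * growth ^+ (n0 + m))).
  move=> yX; apply: (hits_unlikely_small chern eps0 delta0 yX) => [|c|c].
  - by move=> c c' cc'; rewrite /G (dep_passes_upto cc').
  - exact: ler0n.
  - by rewrite /G pnatr_eq0 eqb0 negbK => /passes_uptoW.
(* Union bound: the indicator of the longer window is at least [G] minus [G] times the number of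
   tests that fail in the new generation. *)
apply: (@le_trans _ _ (expect p ((n0 + m).+1 * r) (fun c => G c -
    \sum_(y <- X (n0 + m).+1) G c * (hits (n0 + m).+1 y c < growth ^+ (n0 + m).+1)%R%:R))).
  rewrite /expect ExB Ex_sum -!/(expect _ _ _) -GE mulrBr mulr1 lerD2l lerN2.
  apply: (@le_trans _ _ (\sum_(y <- X (n0 + m).+1) E * expR (- (delta * growth ^+ (n0 + m))))).
    by rewrite big_seq [leRHS]big_seq; apply: ler_sum.
  rewrite big_const_seq count_predT iter_addr_0.
  rewrite -mulrnAr -mulr_natl.
  have E0 : 0 <= E by apply: Ex_ge0 => [|c]; [exact: q01|rewrite ler0n].
  rewrite ler_wpM2l //; apply: le_trans (n0P m).
  by rewrite ler_wpM2r ?expR_ge0 // ler_nat.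
rewrite addnS; apply: Ex_le => [|c]; first exact: q01.
rewrite /G /= addnS; case: (passes_upto n0 m c) => /=; last first.
  by rewrite big1 ?subr0 // => y _; rewrite mul0r.
case: (boolP (passes _ c)) => [_|/allPn[y yX]].
  by rewrite lerBlDr lerDl sumr_ge0 // => y _; rewrite mulr_ge0 ?ler0n.
rewrite -ltNge => small_y; rewrite (big_rem y yX) /= small_y mulr1 opprD addrA subrr.
by rewrite sub0r oppr_le0 sumr_ge0 // => z _; rewrite mulr_ge0 ?ler0n.
Qed.

End TestSystem.

(** * Lines and cells *)

(** The failures of the successive windows increase and have probability at most [1 - a < 1], so
    [ae_good_subtree] yields a live [u] whose subtree passes in every generation from [n0] on. A
    number of hits at least [growth ^+ n > 0] then provides a live cell. *)
Theorem ae_tests_hit (d : measure_display) (T : measurableType d) (R : realType)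
    (P : probability T R) (D : finType) (p : D -> R) (A : edge D -> set T)
    (tau : eqType) (X : nat -> seq tau) (S : nat -> tau -> seq D -> bool)
    (r C K : nat) (gamma : R) :
  (forall a, 0 <= p a <= 1) -> 1 < \sum_a p a ->
  (forall x, measurable (A x)) -> (forall x, P (A x) = (bernoulli_param p x)%:E) ->
  mutually_independent P A ->
  (forall n, (size (X n) <= C * K ^ n)%N) ->
  (forall x, x \in X 0 -> S 0 x [::]) ->
  (forall n y, y \in X n.+1 -> exists2 x, x \in X n &
    forall w, size w = (n * r)%N -> S n x w ->
      gamma <= \sum_(v <- words D r | S n.+1 y (w ++ v)) \prod_(a <- v) p a) ->
  1 < gamma ->
  {ae P, forall omega,
    (forall n, exists2 w, size w = n & alive (config A omega) w) ->
    exists2 u, alive (config A omega) u &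
      exists n0, forall n, (n0 <= n)%N -> forall x, x \in X n ->
        exists w, [/\ size w = (n * r)%N, S n x w & alive (config A omega) (u ++ w)]}.
Proof.
move=> p01 psum mA PA indepA cardX X0 Xpar gamma1.
pose growth := (1 + gamma) / 2.
have growth1 : 1 < growth by rewrite /growth; lra.
have growthg : growth < gamma by rewrite /growth; lra.
have [n0 [a [a0 Ha]]] := passes_likely p01 cardX X0 Xpar growth1 growthg.
pose B m c := ~~ passes_upto X S r growth n0 m c.
have dB m : dep_tree ((n0 + m) * r) (B m).
  by move=> c c' cc'; rewrite /B (dep_passes_upto X S growth cc').
have Bmono m c : B m c -> B m.+1 c by rewrite /B /= negb_and => ->.
have EB m : expect p ((n0 + m) * r) (fun c => (B m c)%:R) <= 1 - a.
  have -> : expect p ((n0 + m) * r) (fun c => (B m c)%:R) = 1 -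
      expect p ((n0 + m) * r) (fun c => (passes_upto X S r growth n0 m c)%:R).
    rewrite /expect; set s := tree _ _.
    rewrite -[X in X - _](Ex_cst (bernoulli_param p) s 1 (fun=> false)) -ExB.
    by apply: eq_Ex => c; rewrite /B; case: passes_upto; rewrite ?subrr ?subr0.
  by rewrite lerD2l lerN2.
have a1 : 1 - a < 1 by lra.
have := ae_good_subtree p01 psum mA PA indepA dB Bmono a1 EB.
apply: filterS => omega H surv; have [u au Hu] := H surv; exists u => //.
exists n0 => n n0n x xX; have := Hu (n - n0)%N; rewrite /B negbK => /passes_uptoW.
rewrite subnKC // => /allP/(_ x xX); rewrite /hits => hx.
have : ~~ all (fun w => ~~ (S n x w && alive (subtree u (config A omega)) w)) (words D (n * r)).
  apply/negP => /allP none; move: hx; rewrite big_mkcond big_seq big1 => [|w wn].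
    by rewrite leNgt exprn_gt0 // (lt_trans ltr01).
  have := none w wn; rewrite negb_and; case: (S n x w) => //= /negbTE ->.
  by [].
move=> /allPn[w]; rewrite mem_words negbK => /eqP wn /andP[Sw aw].
by exists w; split; rewrite // alive_cat au.
Qed.

(** [G w] says that [w] has good extensions of every length. If no child of [w] inherited this, the
    failing lengths, one for each of the finitely many letters, would have a maximum, against [G w]
    one letter further. *)
Lemma konig (D : finType) (Q : seq D -> Prop) :
  (forall w v, Q (w ++ v) -> Q w) ->
  (forall n, exists2 w, size w = n & Q w) ->
  exists f : nat -> D, forall n, Q (mkseq f n).
Proof.
move=> Qpre Qall.
pose G w := forall n, exists2 v, size v = n & Q (w ++ v).
have step w : G w -> exists a, G (rcons w a).
  move=> Gw; apply: contrapT => /forallNP none.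
  have {}none a : exists n, forall v, size v = n -> ~ Q (rcons w a ++ v).
    by have /existsNP[n /forall2NP nQ] := none a; exists n => v vn; have [] := nQ v.
  have [f fP] := choice none.
  have [[//|a v] [vn] Qv] := Gw (\max_a f a).+1.
  have fa : (f a <= size v)%N by rewrite vn; exact: leq_bigmax.
  apply: (fP a (take (f a) v)); first by rewrite size_takel.
  by apply: (Qpre _ (drop (f a) v)); rewrite -catA cat_take_drop cat_rcons.
have Gnil : G [::] by [].
have [a0 _] := step _ Gnil.
have [g gP] : {g : seq D -> D & forall w, G w -> G (rcons w (g w))}.
  apply: (choice (P := fun w a => G w -> G (rcons w a))) => w.
  have [/step[a Ga]|nG] := pselect (G w); first by exists a.
  by exists a0.
pose ws n := iter n (fun w => rcons w (g w)) [::].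
exists (g \o ws) => n.
have -> : mkseq (g \o ws) n = ws n by elim: n => // n IH; rewrite mkseqS IH.
have : G (ws n) by elim: n => // n IH; exact: gP.
by move=> /(_ 0%N)[v /size0nil -> ]; rewrite cats0.
Qed.

Lemma nested_intervals (R : realType) (u e : nat -> R) :
  (forall n, 0 <= e n) -> (forall n, u n <= u n.+1) ->
  (forall n, u n.+1 + e n.+1 <= u n + e n) ->
  exists z, forall n, u n <= z <= u n + e n.
Proof.
move=> e0 uS eS.
have umono m n : (m <= n)%N -> u m <= u n.
  by move=> /subnK <-; elim: (n - m)%N => // k IH; rewrite addSn (le_trans IH).
have emono m n : (m <= n)%N -> u n + e n <= u m + e m.
  by move=> /subnK <-; elim: (n - m)%N => // k IH; rewrite addSn (le_trans _ IH).
have ub n : ubound (range u) (u n + e n).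
  move=> _ [m _ <-]; apply: (@le_trans _ _ (u (maxn m n))).
    by rewrite umono ?leq_maxl.
  by apply: (le_trans _ (emono _ _ (leq_maxr m n))); rewrite lerDl.
exists (sup (range u)) => n; apply/andP; split.
  by apply: ub_le_sup; [exists (u 0%N + e 0%N); exact: ub|exists n].
by apply: ge_sup; [exists (u 0%N), 0%N|exact: ub].
Qed.

Section Geometry.
Variables (R : realType) (M : nat).
Hypothesis M2 : (2 <= M)%N.
Local Notation D := ('I_M * 'I_M)%type.

Let M0 : 0 < M%:R :> R. Proof. by rewrite ltr0n (ltn_trans _ M2). Qed.
Let Mn0 n : 0 < (M%:R : R) ^- n. Proof. by rewrite invr_gt0 exprn_gt0. Qed.
Let MnS n : (M%:R : R) ^- n = M%:R * M%:R ^- n.+1.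
Proof. by rewrite exprS invfM mulrA divff ?mul1r // gt_eqF. Qed.

(* With [dg := slope lambda flip], [zoom dg w] maps the projection of the cell [w]
   to the diagonal affinely onto [[0, 1]]; it is the composition of the maps
   psi of the paper along [w]. *)
Fixpoint zoom (dg : D -> R) (w : seq D) (t : R) : R :=
  if w is a :: w' then zoom dg w' (M%:R * t - dg a) else t.

Lemma zoom_cat dg w v t : zoom dg (w ++ v) t = zoom dg v (zoom dg w t).
Proof. by elim: w t => //= a w IH t. Qed.

Lemma zoom_prefix dg w v t : (forall a, 0 <= dg a <= M%:R - 1) ->
  0 <= zoom dg (w ++ v) t <= 1 -> 0 <= zoom dg w t <= 1.
Proof.
move=> dg01; rewrite zoom_cat; elim: v (zoom dg w t) => //= a v IH s /IH /andP[h0 h1].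
have /andP[a0 a1] := dg01 a.
rewrite -(pmulr_rge0 _ M0) -(ler_pM2l M0 s) mulr1; apply/andP; split; lra.
Qed.

Lemma corner_rcons (w : word M) (a : D) :
  ((corner R (rcons w a)).1 = (corner R w).1 + a.1%:R * M%:R ^- (size w).+1) *
  ((corner R (rcons w a)).2 = (corner R w).2 + a.2%:R * M%:R ^- (size w).+1).
Proof.
have cornerE (v : word M) : corner R v =
    (\sum_(l < size v) (nth a v l).1%:R * M%:R ^- l.+1,
     \sum_(l < size v) (nth a v l).2%:R * M%:R ^- l.+1).
  by congr (_, _); apply: eq_bigr => l _; rewrite (tnth_nth a).
rewrite !cornerE size_rcons !big_ord_recr /= !nth_rcons ltnn eqxx.
by split; congr (_ + _); apply: eq_bigr => l _; rewrite nth_rcons ltn_ord.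
Qed.

Definition flip_coord (flip : bool) (y : R) : R := if flip then 1 - y else y.

(* The parameter on the diagonal of the line through [z], for projections onto
   the diagonal from (0,0) to (1,1), or from (0,1) to (1,0) when [flip]. The values
   [lambda = 1] and [lambda = 0] are the projections to the coordinate axes. *)
Definition line_coord (lambda : R) (flip : bool) (z : R * R) : R :=
  lambda * z.1 + (1 - lambda) * flip_coord flip z.2.

Definition slope (lambda : R) (flip : bool) (a : D) : R :=
  lambda * a.1%:R + (1 - lambda) * (if flip then M%:R - 1 - a.2%:R else a.2%:R).

Lemma slope_bounds lambda flip a : 0 <= lambda <= 1 ->
  0 <= slope lambda flip a <= M%:R - 1.
Proof.
move=> /andP[l0 l1].
have dig (i : 'I_M) : 0 <= (i%:R : R) <= M%:R - 1.
  by rewrite ler0n lerBrDr natr1 ler_nat ltn_ord.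
have /andP[a0 a1] := dig a.1.
have /andP[b0 b1] : 0 <= (if flip then M%:R - 1 - a.2%:R else a.2%:R : R) <= M%:R - 1.
  by have := dig a.2; case: flip => // /andP[? ?]; apply/andP; split; lra.
have l1' : 0 <= 1 - lambda by rewrite subr_ge0.
rewrite /slope; apply/andP; split; first by rewrite addr_ge0 ?mulr_ge0.
rewrite [leRHS](_ : _ = lambda * (M%:R - 1) + (1 - lambda) * (M%:R - 1)); last by ring.
by rewrite lerD // ler_wpM2l.
Qed.

(** [zoom] is the relative position of [t] in the projection of the cell, an interval of length
    [M ^- size w]. Its left end is the projection of the lower left corner, or of the upper left one
    when [flip] reverses the second axis. *)
Lemma zoom_slope lambda flip w t :
  t = lambda * (corner R w).1 + (1 - lambda) *
      (if flip then 1 - (corner R w).2 - M%:R ^- size w else (corner R w).2) +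
      M%:R ^- size w * zoom (slope lambda flip) w t.
Proof.
elim/last_ind: w => [|w a IH].
  by rewrite /corner /= !big_ord0 expr0 invr1; case: flip; ring.
rewrite !corner_rcons size_rcons -cats1 zoom_cat {1}IH (MnS (size w)).
case: (corner R w) {IH} => x y; rewrite /slope /=.
set h := M%:R ^- (size w).+1; set Z := zoom _ _ _; clearbody Z h.
by case: flip; ring.
Qed.

Lemma cell_line_coord lambda flip w t z : 0 <= lambda <= 1 -> cell R w z ->
  0 <= zoom (slope lambda flip) w t <= 1 ->
  `|line_coord lambda flip z - t| <= M%:R ^- size w.
Proof.
move=> /andP[l0 l1] [/andP[z1 z1'] /andP[z2 z2']] /andP[t0 t1].
rewrite {1}(zoom_slope lambda flip w t) /line_coord /flip_coord.
set Z := zoom _ _ _ in t0 t1 *; set h := M%:R ^- size w in z1 z1' z2 z2' *.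
have h0 : 0 < h by exact: Mn0.
set x := (corner R w).1 in z1 z1' *; set y := (corner R w).2 in z2 z2' *.
have l1' : 0 <= 1 - lambda by rewrite subr_ge0.
have Z0 : 0 <= h * Z by rewrite mulr_ge0 // ltW.
have Z1 : h * Z <= h by rewrite ler_piMr // ltW.
have A0 : 0 <= lambda * (z.1 - x) by rewrite mulr_ge0 // subr_ge0.
have A1 : 0 <= lambda * (x + h - z.1) by rewrite mulr_ge0 // subr_ge0.
have B0 : 0 <= (1 - lambda) * (z.2 - y) by rewrite mulr_ge0 // subr_ge0.
have B1 : 0 <= (1 - lambda) * (y + h - z.2) by rewrite mulr_ge0 // subr_ge0.
clearbody Z x y h.
by rewrite ler_norml; case: flip; apply/andP; split; lra.
Qed.

Lemma survivingP (T : Type) (A : word M * D -> set T) omega n w :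
  surviving A omega n w <-> size w = n /\ alive (config A omega) w.
Proof.
elim: n w => [|n IH] w /=.
  by split=> [->//|[/size0nil -> _]].
split=> [[v [a [/IH[vn av] Aa ->]]]|].
  rewrite size_rcons vn; split=> //; rewrite alive_rcons av /=.
  exact/asboolP.
case/lastP: w => [[]//|v a]; rewrite size_rcons => -[[vn]].
rewrite alive_rcons => /andP[av /asboolP Aa].
by exists v, a; split=> //; apply/IH.
Qed.

(** The live words whose projected cells contain [t] are closed under prefixes, so there is an
    infinite branch of them. Its nested cells share a point, whose coordinate is within [M ^- n] of
    [t] for every [n]. *)
Lemma line_hits (T : Type) (A : word M * D -> set T) omega lambda flip t :
  0 <= lambda <= 1 ->
  (forall N, exists2 w, (N <= size w)%N &
     alive (config A omega) w /\ 0 <= zoom (slope lambda flip) w t <= 1) ->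
  exists2 z, percolation_set R A omega z & line_coord lambda flip z = t.
Proof.
move=> l01 hits.
pose Q w := alive (config A omega) w /\ 0 <= zoom (slope lambda flip) w t <= 1.
have Qpre w v : Q (w ++ v) -> Q w.
  rewrite /Q alive_cat => -[/andP[aw _] zwv]; split => //.
  by apply: zoom_prefix zwv => a; exact: slope_bounds.
have [f fQ] : exists f, forall n, Q (mkseq f n).
  apply: konig => // n; have [w nw Qw] := hits n; exists (take n w).
    by rewrite size_takel.
  by apply: (Qpre _ (drop n w)); rewrite cat_take_drop.
have dig (i : 'I_M) n : 0 <= i%:R * (M%:R : R) ^- n /\
    i%:R * (M%:R : R) ^- n.+1 + M%:R ^- n.+1 <= M%:R ^- n.
  split; first by rewrite mulr_ge0 ?ler0n // ltW.
  rewrite (MnS n) -[X in _ + X]mul1r -mulrDl ler_pM2r // natr1 ler_nat.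
  exact: ltn_ord.
have [z1 z1P] : exists z, forall n, (corner R (mkseq f n)).1 <= z <=
    (corner R (mkseq f n)).1 + M%:R ^- n.
  apply: nested_intervals => n; first exact: ltW.
    by rewrite mkseqS corner_rcons lerDl; have [] := dig (f n).1 (size (mkseq f n)).+1.
  rewrite mkseqS corner_rcons size_mkseq -addrA lerD2l.
  by have [] := dig (f n).1 n.
have [z2 z2P] : exists z, forall n, (corner R (mkseq f n)).2 <= z <=
    (corner R (mkseq f n)).2 + M%:R ^- n.
  apply: nested_intervals => n; first exact: ltW.
    by rewrite mkseqS corner_rcons lerDl; have [] := dig (f n).2 (size (mkseq f n)).+1.
  rewrite mkseqS corner_rcons size_mkseq -addrA lerD2l.
  by have [] := dig (f n).2 n.
have cz n : cell R (mkseq f n) (z1, z2).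
  by split; rewrite size_mkseq /=; [exact: z1P|exact: z2P].
exists (z1, z2).
  move=> n _; exists (mkseq f n); last exact: cz.
  by apply/survivingP; rewrite size_mkseq; have [] := fQ n.
apply/eqP; rewrite -subr_eq0 -normr_eq0 eq_le normr_ge0 andbT leNgt; apply/negP => pos.
have [n nP] : exists n, `|line_coord lambda flip (z1, z2) - t|^-1 < M%:R ^+ n.
  by apply: expr_gt_any; rewrite ltr1n.
have := cell_line_coord l01 (cz n) (proj2 (fQ n)); rewrite size_mkseq leNgt.
by rewrite -[X in _ < X]invrK ltf_pV2 ?posrE ?invr_gt0 ?exprn_gt0 // nP.
Qed.

End Geometry.

(** * Almost sure hitting of lines *)

Definition hits_interval (R : realType) (T : Type) (M : nat)
    (A : word M * ('I_M * 'I_M) -> set T) (lambda : R) (flip : bool) omega :=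
  exists a b : R, a < b /\ forall t, a <= t <= b ->
    exists2 z, percolation_set R A omega z & line_coord lambda flip z = t.

Section Lines.
Variables (d : measure_display) (T : measurableType d) (R : realType).
Variables (P : probability T R) (M : nat) (p : 'I_M -> 'I_M -> R).
Local Notation D := ('I_M * 'I_M)%type.
Variable A : word M * D -> set T.
Hypothesis M2 : (2 <= M)%N.
Hypothesis p01 : forall i j, 0 <= p i j <= 1.
Hypothesis psum : M%:R < \sum_(i < M) \sum_(j < M) p i j.
Hypothesis percoA : percolation_events P p A.

Let M0 : 0 < M%:R :> R. Proof. by rewrite ltr0n (ltn_trans _ M2). Qed.
Let M2R : 2 <= M%:R :> R. Proof. by rewrite ler_nat. Qed.
Let M1R : 1 <= M%:R :> R. Proof. by rewrite ler1n (leq_trans _ M2). Qed.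

Let pD (a : D) := p a.1 a.2.

Let pD01 a : 0 <= pD a <= 1. Proof. exact: p01. Qed.

Let pDsum : 1 < \sum_a pD a.
Proof. by apply: le_lt_trans M1R _; move: psum; rewrite pair_big. Qed.

Let mA x : measurable (A x). Proof. by case: percoA. Qed.

Let PA (x : edge D) : P (A x) = (bernoulli_param pD x)%:E.
Proof. by case: x => w [i j]; case: percoA. Qed.

Let indepA : mutually_independent P (A : edge D -> set T).
Proof. by case: percoA. Qed.

Lemma percolation_set_survives omega : percolation_set R A omega !=set0 ->
  forall n, exists2 w, size w = n & alive (config (A : edge D -> set T) omega) w.
Proof.
move=> [z Ez] [|n]; first by exists [::].
by have [w /survivingP[wn aw] _] := Ez n.+1 isT; exists w.
Qed.

Lemma zoom_preimage (dg : D -> R) (u : seq D) (a b : R) : a < b ->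
  exists a' b', a' < b' /\ forall t, a' <= t <= b' -> a <= zoom dg u t <= b.
Proof.
elim: u a b => [|x u IH] a b ab; first by exists a, b.
have [a' [b' [ab' H]]] := IH a b ab.
exists ((a' + dg x) / M%:R), ((b' + dg x) / M%:R); split.
  by rewrite ltr_pM2r ?invr_gt0 // ltrD2r.
move=> t; rewrite ler_pdivrMr // ler_pdivlMr // => /andP[ta tb].
by apply: H; apply/andP; split; rewrite ?lerBrDr ?lerBlDr mulrC.
Qed.

Lemma size_words (E : finType) k : size (words E k) = (#|E| ^ k)%N.
Proof. by elim: k => //= k IH; rewrite size_allpairs -cardE IH expnS. Qed.

Lemma digit_cover (dg : D -> 'I_M) n (s : R) : 0 <= s <= 1 ->
  exists2 x : seq 'I_M, size x = n & forall w, map dg w = x ->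
    0 <= zoom (fun a => (dg a)%:R) w s <= 1.
Proof.
elim: n s => [|n IH] s s01; first by exists [::] => // -[].
have [i iP] : exists i : 'I_M, 0 <= M%:R * s - i%:R <= 1.
  have /andP[s0 s1] := s01.
  have [sM|sM] := ltP s 1.
    have Ms0 : 0 <= M%:R * s by rewrite mulr_ge0 // ltW.
    have /andP[k0 k1] := truncn_itv Ms0.
    have kM : (Num.truncn (M%:R * s) < M)%N.
      by rewrite -(ltr_nat R) (le_lt_trans k0) // gtr_pMr.
    exists (Ordinal kM); rewrite /= subr_ge0 k0 lerBlDl /=.
    by rewrite natr1 ltW.
  (* At the right end truncation would give the digit [M]; the digit [M - 1], with remainder 1, is
     taken instead. *)
  have -> : s = 1 by apply/eqP; rewrite eq_le s1.
  have kM : (M.-1 < M)%N by rewrite prednK // (ltn_trans _ M2).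
  exists (Ordinal kM); rewrite /= mulr1 -natrB ?leq_pred // -subn1 subKn ?ler0n ?lexx //.
  exact: ltn_trans M2.
have [x xn Hx] := IH _ iP; exists (i :: x); first by rewrite /= xn.
by move=> [//|a w] [di wx] /=; rewrite di; exact: Hx.
Qed.

(** The slope being a digit, a test of generation [n] is a whole column or row, named by its [n]
    digits. There are [M ^ n] of them, no approximation is involved, [r = 1], and [gamma] is the
    smallest of the finitely many sums. *)
Lemma ae_axis (dg : D -> 'I_M) (lambda : R) : 0 <= lambda <= 1 ->
  (forall a, slope lambda false a = (dg a)%:R) ->
  (forall i, 1 < \sum_(a | dg a == i) pD a) ->
  {ae P, forall omega, percolation_set R A omega !=set0 ->
    hits_interval A lambda false omega}.
Proof.
move=> l01 slopeE sum1.
have M_gt0 : (0 < M)%N by exact: ltn_trans M2.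
have [gamma gamma1 gammaP] : exists2 gamma : R, 1 < gamma &
    forall i, gamma <= \sum_(a | dg a == i) pD a.
  case: (@arg_minP _ R _ (Ordinal M_gt0) xpredT (fun i => \sum_(a | dg a == i) pD a)) => //.
  by move=> i _ Hi; exists (\sum_(a | dg a == i) pD a) => // j; exact: Hi.
pose S (n : nat) x w := map dg w == x.
have cardX n : (size (words 'I_M n) <= 1 * M ^ n)%N.
  by rewrite mul1n size_words card_ord.
have X0 x : x \in words 'I_M 0 -> S 0 x [::] by rewrite mem_words => /eqP/size0nil ->.
have Xpar n y : y \in words 'I_M n.+1 -> exists2 x, x \in words 'I_M n &
    forall w, size w = (n * 1)%N -> S n x w ->
    gamma <= \sum_(v <- words D 1 | S n.+1 y (w ++ v)) \prod_(a <- v) pD a.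
  rewrite mem_words; case/lastP: y => [//|x i]; rewrite size_rcons eqSS => xn.
  exists x; first by rewrite mem_words.
  move=> w _ /eqP wx; apply: (le_trans (gammaP i)).
  rewrite -[words D 1]/[seq a :: v | a <- enum {: D}, v <- [:: [::]]].
  rewrite [leRHS]big_mkcond big_allpairs_dep /= big_enum /= big_mkcond /=.
  apply: ler_sum => a _; rewrite big_cons big_nil addr0 /S map_cat wx /= cats1.
  by rewrite eqseq_rcons eqxx /= big_cons big_nil mulr1.
have := ae_tests_hit pD01 pDsum mA PA indepA cardX X0 Xpar gamma1.
apply: filterS => omega H /percolation_set_survives/H[u au [n0 Hu]].
have [a [b [ab Hab]]] := zoom_preimage (slope lambda false) u ltr01.
exists a, b; split=> // t /Hab zu; apply: line_hits => // N.
have [x xn Hx] := digit_cover dg (maxn n0 N) zu.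
have [|w [wn /eqP wx aw]] := Hu (maxn n0 N) (leq_maxl _ _) x.
  by rewrite mem_words xn.
exists (u ++ w); first by rewrite size_cat wn muln1 (leq_trans (leq_maxr n0 N)) ?leq_addl.
split=> //; rewrite zoom_cat.
have -> : slope lambda false = (fun a => (dg a)%:R) by apply/funext.
by rewrite -[X in zoom X u t](funext slopeE) Hx.
Qed.

(** Each letter expands by [M] and shifts by slopes that differ by at most M |l - l'|; the constant
    2 closes the induction because M + 2 <= 2 M. *)
Lemma zoom_lipschitz flip (w : seq D) (l l' t t' : R) :
  `|zoom (slope l flip) w t - zoom (slope l' flip) w t'| <=
  M%:R ^+ size w * (`|t - t'| + 2 * `|l - l'|).
Proof.
elim: w t t' => [|a w IH] t t' /=; first by rewrite expr0 mul1r lerDl mulr_ge0.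
apply: (le_trans (IH _ _)); rewrite exprS -mulrA mulrCA ler_pM2l ?exprn_gt0 //.
pose e : R := a.1%:R - (if flip then M%:R - 1 - a.2%:R else a.2%:R).
have dig (i : 'I_M) : 0 <= (i%:R : R) <= M%:R - 1.
  by rewrite ler0n lerBrDr natr1 ler_nat ltn_ord.
have eM : `|e| <= M%:R.
  have /andP[? ?] := dig a.1; have /andP[? ?] := dig a.2.
  by rewrite ler_norml /e; case: ifP => _; apply/andP; split; lra.
have -> : M%:R * t - slope l flip a - (M%:R * t' - slope l' flip a) =
    M%:R * (t - t') - (l - l') * e by rewrite /slope /e; ring.
apply: (@le_trans _ _ (M%:R * `|t - t'| + M%:R * `|l - l'| + 2 * `|l - l'|)).
  rewrite lerD2r (le_trans (ler_normB _ _)) // normrM gtr0_norm // lerD2l.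
  by rewrite normrM mulrC ler_wpM2r.
rewrite mulrDr -addrA lerD2l mulrA -mulrDl ler_wpM2r //.
by have := M2R; lra.
Qed.

Lemma grid_approx (lo hi x : R) (L : nat) : (0 < L)%N -> lo <= x <= hi ->
  exists2 i, (i <= L)%N & `|x - (lo + (hi - lo) * (i%:R / L%:R))| <= (hi - lo) / L%:R.
Proof.
move=> L0 /andP[lx xh]; have L0' : 0 < L%:R :> R by rewrite ltr0n.
have [hl|lh] := leP hi lo.
  have [xl hE] : x = lo /\ hi = lo by split; lra.
  by exists 0%N => //; rewrite xl hE !mul0r mulr0 addr0 !subrr normr0 mul0r.
have hl0 : 0 < hi - lo by rewrite subr_gt0.
pose s := (x - lo) / (hi - lo) * L%:R.
have s0 : 0 <= s by rewrite /s mulr_ge0 ?ler0n // divr_ge0 ?subr_ge0 // ltW.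
have /andP[k0 k1] := truncn_itv s0.
have sL : s <= L%:R by rewrite /s ler_piMl ?ler0n // ler_pdivrMr // mul1r lerD2r.
exists (Num.truncn s); first by rewrite -(ler_nat R) (le_trans k0).
have -> : x = lo + (hi - lo) * (s / L%:R).
  by rewrite /s mulfK ?gt_eqF // mulrCA divff ?gt_eqF // mulr1 addrC subrK.
rewrite opprD addrACA subrr add0r -mulrBr -mulrBl normrM gtr0_norm //.
rewrite ler_wpM2l ?(ltW hl0) // normrM (gtr0_norm (_ : 0 < L%:R^-1)) ?invr_gt0 //.
rewrite ger0_norm ?subr_ge0 // ler_piMl ?invr_ge0 ?(ltW L0') //.
by rewrite lerBlDl natr1 // ltW.
Qed.

(* The lines with parameters near [lambda0] are tested along a grid of mesh
   comparable to [M ^- (n * r)]; the room between [I_1] and [I_2] absorbs both the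
   distance to the grid and the change of [lambda]. *)
Lemma ae_generic (lambda0 a1 b1 a2 b2 : R) (flip : bool) (r : nat) : (0 < r)%N ->
  0 <= a2 -> a2 < a1 -> a1 < b1 -> b1 < b2 -> b2 <= 1 ->
  (forall t, a2 <= t <= b2 -> 2 <=
    \sum_(w <- words D r | a1 <= zoom (slope lambda0 flip) w t <= b1) \prod_(a <- w) pD a) ->
  exists2 eta : R, 0 < eta & {ae P, forall omega, percolation_set R A omega !=set0 ->
    forall lambda, 0 <= lambda <= 1 -> `|lambda - lambda0| <= eta ->
      hits_interval A lambda flip omega}.
Proof.
move=> r0 a20 a21 ab1 b12 b21 cond.
(* [I_1] widened by [2 * zeta] stays inside [I_2]: one [zeta] is the tolerance built into [S], the
   other pays for moving to a grid point. *)
have [zeta [zeta0 za zb]] : exists zeta : R,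
    [/\ 0 < zeta, a2 <= a1 - 2 * zeta & b1 + 2 * zeta <= b2].
  exists (Num.min (a1 - a2) (b2 - b1) / 2).
  have m1 : Num.min (a1 - a2) (b2 - b1) <= a1 - a2 by rewrite ge_min lexx.
  have m2 : Num.min (a1 - a2) (b2 - b1) <= b2 - b1 by rewrite ge_min lexx orbT.
  have m0 : 0 < Num.min (a1 - a2) (b2 - b1) by rewrite lt_min !subr_gt0 a21.
  by split; lra.
have Mr0 : 0 < (M%:R : R) ^+ r by rewrite exprn_gt0.
(* Over [r] generations, a change of the slope parameter by at most [eta] moves [zoom] by at most
   [zeta]. *)
pose eta := zeta / (2 * M%:R ^+ r).
have eta0 : 0 < eta by rewrite divr_gt0 // mulr_gt0.
have etaE : M%:R ^+ r * (2 * eta) = zeta by rewrite /eta; field; rewrite gt_eqF.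
exists eta => //.
(* The numerator adds the range of [t] and twice the range of the slope parameter, as in
   [zoom_lipschitz]; the grid error then remains at most [zeta] after expansion by
   [M ^+ (n * r)]. *)
pose L1 := (Num.truncn ((b1 - a1 + 4 * eta) / zeta)).+1.
have L1P : b1 - a1 + 4 * eta <= zeta * L1%:R.
  by rewrite [leRHS]mulrC -ler_pdivrMr // ltW // /L1 truncnS_gt.
pose L n := (L1 * M ^ (n * r))%N.
have L0 n : (0 < L n)%N by rewrite muln_gt0 /= expn_gt0 (ltn_trans _ M2).
pose X n := [seq (i, j) | i <- iota 0 (L n).+1, j <- iota 0 (L n).+1].
pose lam n i : R := lambda0 - eta + (lambda0 + eta - (lambda0 - eta)) * (i%:R / (L n)%:R).
pose tt n j : R := a1 + (b1 - a1) * (j%:R / (L n)%:R).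
pose S n (x : nat * nat) (w : seq D) :=
  a1 - zeta <= zoom (slope (lam n x.1) flip) w (tt n x.2) <= b1 + zeta.
have memX n x : (x \in X n) = (x.1 <= L n)%N && (x.2 <= L n)%N.
  apply/allpairsP/andP => [[y []]|[x1 x2]].
    by rewrite !mem_iota !ltnS => /andP[_ ?] /andP[_ ?] ->.
  by exists x; rewrite !mem_iota !ltnS x1 x2 -surjective_pairing.
have frac n i : (i <= L n)%N -> 0 <= (i%:R / (L n)%:R : R) <= 1.
  by move=> iL; rewrite divr_ge0 ?ler0n //= ler_pdivrMr ?ltr0n // mul1r ler_nat.
have tt_in n j : (j <= L n)%N -> a1 <= tt n j <= b1.
  move=> /frac/andP[f0 f1]; rewrite /tt lerDl mulr_ge0 ?subr_ge0 ?(ltW ab1) //=.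
  by rewrite -lerBrDl ler_piMr // subr_ge0 ltW.
have lam_in n i : (i <= L n)%N -> lambda0 - eta <= lam n i <= lambda0 + eta.
  move=> /frac/andP[f0 f1].
  have e0 : 0 <= lambda0 + eta - (lambda0 - eta) by lra.
  by rewrite /lam lerDl mulr_ge0 //= -lerBrDl ler_piMr.
have approx n l t : lambda0 - eta <= l <= lambda0 + eta -> a1 <= t <= b1 ->
    exists2 x, x \in X n & forall w : seq D, size w = (n * r)%N ->
      `|zoom (slope l flip) w t - zoom (slope (lam n x.1) flip) w (tt n x.2)| <= zeta.
  move=> lin tin; have [i iL Hi] := grid_approx (L0 n) lin.
  have [j jL Hj] := grid_approx (L0 n) tin.
  exists (i, j); first by rewrite memX iL.
  move=> w wn; apply: (le_trans (zoom_lipschitz _ _ _ _ _ _)); rewrite wn /=.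
  have Mn0 : 0 < (M%:R : R) ^+ (n * r) by rewrite exprn_gt0.
  apply: (@le_trans _ _ (M%:R ^+ (n * r) * ((b1 - a1 + 4 * eta) / (L n)%:R))).
    rewrite ler_pM2l // [leRHS]mulrDl lerD //.
    have -> : 4 * eta / (L n)%:R = 2 * ((lambda0 + eta - (lambda0 - eta)) / (L n)%:R).
      by field; rewrite pnatr_eq0 -lt0n.
    by rewrite ler_pM2l.
  rewrite /L natrM natrX invfM mulrC -mulrA -mulrA mulVf ?gt_eqF // mulr1.
  by rewrite ler_pdivrMr // ltr0n.
have cardX n : (size (X n) <= (2 * L1) ^ 2 * (M ^ (2 * r)) ^ n)%N.
  rewrite size_allpairs !size_iota.
  have -> : ((2 * L1) ^ 2 * (M ^ (2 * r)) ^ n = (2 * L n) ^ 2)%N.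
    rewrite /L mulnA; move: (2 * L1)%N => l; rewrite [RHS]expnMn; congr muln.
    by rewrite -!expnM -mulnA mulnC (mulnC r).
  have h : ((L n).+1 <= 2 * L n)%N by rewrite mul2n -addnn -addn1 leq_add2l L0.
  by rewrite expnS expn1 leq_mul.
have X0 x : x \in X 0%N -> S 0%N x [::].
  rewrite memX => /andP[_ /tt_in/andP[t0 t1]]; rewrite /S /=.
  by apply/andP; split; lra.
have Xpar n y : y \in X n.+1 -> exists2 x, x \in X n &
    forall w : seq D, size w = (n * r)%N -> S n x w ->
    2 <= \sum_(v <- words D r | S n.+1 y (w ++ v)) \prod_(a <- v) pD a.
  rewrite memX => /andP[/lam_in lin /tt_in tin].
  (* The parent of [y] is a coarser grid point approximating the same line. In a cell accepted for
     the parent, the line of [y] passes within [2 * zeta] of [I_1], hence through [I_2], where the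
     bound at [lambda0] applies. *)
  have [x xX Hx] := approx n _ _ lin tin; exists x => // w wn /andP[S1 S2].
  have := Hx w wn; set s := zoom _ w _ => Hs.
  have sI : a2 <= s <= b2.
    by move: Hs; rewrite ler_norml => /andP[? ?]; apply/andP; split; lra.
  apply: (le_trans (cond _ sI)); rewrite big_mkcond [leRHS]big_mkcond /=.
  rewrite big_seq [leRHS]big_seq; apply: ler_sum => v; rewrite mem_words => /eqP vr.
  have v0 : 0 <= \prod_(a <- v) pD a.
    by rewrite prodr_ge0 // => a _; have /andP[] := pD01 a.
  case: ifP => [/andP[v1 v2]|_]; last by case: ifP.
  rewrite ifT // /S zoom_cat -/s.
  (* Going back from [lambda0] to the slope parameter of [y] costs the [zeta] that [S] tolerates. *)
  have := zoom_lipschitz flip v (lam n.+1 y.1) lambda0 s s.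
  rewrite subrr normr0 add0r vr => dv.
  have {}dv : `|zoom (slope (lam n.+1 y.1) flip) v s - zoom (slope lambda0 flip) v s| <= zeta.
    apply: (le_trans dv); rewrite -etaE ler_pM2l // ler_pM2l //.
    by rewrite ler_distl.
  by move: dv; rewrite ler_norml => /andP[? ?]; apply/andP; split; lra.
have two : 1 < 2 :> R by rewrite ltr1n.
have := ae_tests_hit pD01 pDsum mA PA indepA cardX X0 Xpar two.
apply: filterS => omega H /percolation_set_survives/H[u au [n0 Hu]] l l01 leta.
have lin : lambda0 - eta <= l <= lambda0 + eta by rewrite -ler_distl.
have [a [b [ab Hab]]] := zoom_preimage (slope l flip) u ab1.
exists a, b; split=> // t /Hab zu; apply: line_hits => // N.
have [x xX Hx] := approx (maxn n0 N) _ _ lin zu.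
have [w [wn /andP[S1 S2] aw]] := Hu (maxn n0 N) (leq_maxl _ _) x xX.
exists (u ++ w).
  rewrite size_cat wn (leq_trans (leq_maxr n0 N)) // (leq_trans _ (leq_addl _ _)) //.
  by rewrite leq_pmulr.
split=> //; rewrite zoom_cat; have := Hx w wn.
by rewrite ler_norml => /andP[? ?]; apply/andP; split; lra.
Qed.

End Lines.

(** * Condition A in the parametrization of the diagonal *)

Section DiagonalCoordinates.
Variables (R : realType) (M : nat).
Hypothesis M2 : (2 <= M)%N.
Local Notation D := ('I_M * 'I_M)%type.
Variable alpha : R.
Hypothesis alpha_dir : dirs R alpha.

Definition dir_flip : bool := ~~ (alpha < pi / 2).
(** Beyond pi / 2, replacing the second coordinate by its flip gives both coefficients of the
    projection the same sign. Dividing by their sum turns it, up to a constant, into a convex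
    combination of weight [dir_lambda]. *)
Definition dir_scale : R := cos alpha + (if dir_flip then - sin alpha else sin alpha).
Definition dir_lambda : R := cos alpha / dir_scale.

Lemma dir_sin_gt0 : 0 < sin alpha.
Proof.
have p2 : 0 < pi / 2 :> R by rewrite divr_gt0 // pi_gt0.
by case: alpha_dir; rewrite /= in_itv /= => /andP[h0 h1]; apply: sin_gt0_pi;
   apply/andP; split; lra.
Qed.

Lemma dir_scale_neq0 : dir_scale != 0 /\ 0 <= dir_lambda <= 1.
Proof.
have s0 := dir_sin_gt0; have p2 : 0 < pi / 2 :> R by rewrite divr_gt0 // pi_gt0.
rewrite /dir_lambda /dir_scale /dir_flip.
case: alpha_dir; rewrite /= in_itv /= => /andP[h0 h1].
  have c0 : 0 < cos alpha by apply: cos_gt0_pihalf; apply/andP; split; lra.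
  have sc : 0 < cos alpha + sin alpha by rewrite addr_gt0.
  rewrite h1 /=; split; first by rewrite gt_eqF.
  by rewrite divr_ge0 ?(ltW c0) ?(ltW sc) //= ler_pdivrMr // mul1r lerDl ltW.
have c0 : cos alpha < 0.
  rewrite -[alpha](subrK pi) cosDpi oppr_lt0; apply: cos_gt0_pihalf.
  by apply/andP; split; lra.
rewrite ltNge (ltW h0) /=; split; first by rewrite lt_eqF // subr_lt0 (lt_trans c0).
have c1 : cos alpha - sin alpha < 0 by lra.
by rewrite ler_ndivlMr // ler_ndivrMr // mul0r mul1r ltW //=; lra.
Qed.

Lemma dir_line_coord (z : R * R) : z.1 * cos alpha + z.2 * sin alpha =
  dir_scale * line_coord dir_lambda dir_flip z + (if dir_flip then sin alpha else 0).
Proof.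
have [s0 _] := dir_scale_neq0; move: s0.
rewrite /line_coord /flip_coord /dir_lambda /dir_scale; case: dir_flip => s0;
by field.
Qed.

Lemma line_coord_diag (t : R) : line_coord dir_lambda dir_flip (diag alpha t) = t.
Proof.
by rewrite /line_coord /flip_coord /diag /dir_flip; case: ltP => _ /=; ring.
Qed.

Lemma diag_inj : injective (diag alpha).
Proof. by move=> s t; rewrite /diag; case: ifP => _ []. Qed.

Lemma line_coord01 (z : R * R) : 0 <= z.1 <= 1 -> 0 <= z.2 <= 1 ->
  0 <= line_coord dir_lambda dir_flip z <= 1.
Proof.
move=> /andP[a0 a1] /andP[b0 b1]; have [_ /andP[l0 l1]] := dir_scale_neq0.
have /andP[c0 c1] : 0 <= flip_coord dir_flip z.2 <= 1.
  by rewrite /flip_coord; case: dir_flip; apply/andP; split; lra.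
have l1' : 0 <= 1 - dir_lambda by rewrite subr_ge0.
rewrite /line_coord; move: dir_lambda l0 l1 l1' => l l0 l1 l1'.
apply/andP; split; first by rewrite addr_ge0 ?mulr_ge0.
rewrite [leRHS](_ : _ = l + (1 - l)); last by ring.
by rewrite lerD // ler_piMr.
Qed.

(** [line_coord] is constant along the fibres and inverts [diag], which leaves a single candidate
    for [xget]; for [z] in the unit square this candidate lies on the diagonal. *)
Lemma Pi_diagE (z : R * R) : 0 <= z.1 <= 1 -> 0 <= z.2 <= 1 ->
  Pi_diag alpha z = diag alpha (line_coord dir_lambda dir_flip z).
Proof.
move=> z1 z2; have s0 := dir_sin_gt0; have [sc0 _] := dir_scale_neq0.
set t := line_coord _ _ _.
have lin (u : R * R) : (exists s, u = (z.1 - s * sin alpha, z.2 + s * cos alpha)) ->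
    line_coord dir_lambda dir_flip u = t.
  move=> [s ->]; apply: (mulfI sc0).
  apply: (addIr (if dir_flip then sin alpha else 0)).
  by rewrite -!dir_line_coord /=; ring.
apply: xget_unique => [|u [[t' _ <-] /lin]]; last first.
  by rewrite line_coord_diag => ->.
split; first by exists t => //; rewrite /= in_itv /= line_coord01.
have E : z.1 * cos alpha + z.2 * sin alpha =
    (diag alpha t).1 * cos alpha + (diag alpha t).2 * sin alpha.
  by rewrite !dir_line_coord line_coord_diag.
exists ((z.1 - (diag alpha t).1) / sin alpha).
rewrite [LHS]surjective_pairing; congr (_, _).
  by field; rewrite gt_eqF.
apply: (mulIf (lt0r_neq0 s0)); rewrite mulrDl mulrAC divfK ?gt_eqF //.
by lra.
Qed.

Lemma line_coord_phi (a : D) (z : R * R) :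
  line_coord dir_lambda dir_flip (phi a.1 a.2 z) =
  (line_coord dir_lambda dir_flip z + slope dir_lambda dir_flip a) / M%:R.
Proof.
have M0 : M%:R != 0 :> R by rewrite pnatr_eq0 -lt0n (ltn_trans _ M2).
rewrite /line_coord /flip_coord /slope /phi /=; move: dir_lambda => l.
by case: dir_flip; field.
Qed.

Lemma phi_unit (a : D) (z : R * R) : 0 <= z.1 <= 1 -> 0 <= z.2 <= 1 ->
  0 <= (phi a.1 a.2 z).1 <= 1 /\ 0 <= (phi a.1 a.2 z).2 <= 1.
Proof.
have M0 : 0 < M%:R :> R by rewrite ltr0n (ltn_trans _ M2).
have coord01 (i : 'I_M) (x : R) : 0 <= x <= 1 -> 0 <= M%:R^-1 * x + i%:R / M%:R <= 1.
  move=> /andP[x0 x1]; rewrite addr_ge0 ?mulr_ge0 ?invr_ge0 ?ler0n //=.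
  rewrite mulrC -mulrDl ler_pdivrMr // mul1r.
  have : (i%:R : R) + 1 <= M%:R by rewrite natr1 ler_nat ltn_ord.
  by lra.
by move=> z1 z2; split; exact: coord01.
Qed.

Lemma Pi_phi_diag (a : D) (t : R) : 0 <= t <= 1 ->
  (Pi_diag alpha \o phi a.1 a.2) (diag alpha t) =
  diag alpha ((t + slope dir_lambda dir_flip a) / M%:R).
Proof.
move=> t01 /=.
have d1 : 0 <= (diag alpha t).1 <= 1 by rewrite /diag; case: ifP.
have d2 : 0 <= (diag alpha t).2 <= 1.
  rewrite /diag; case: ifP => // _ /=.
  by move: t01 => /andP[? ?]; apply/andP; split; lra.
have [f1 f2] := phi_unit a d1 d2.
by rewrite Pi_diagE // line_coord_phi line_coord_diag.
Qed.

(** The hypothesis puts [diag alpha t] in the image of the contraction, where [pinv_] is a genuine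
    inverse rather than a default value. *)
Lemma psi_diag (a : D) (t : R) :
  0 <= M%:R * t - slope dir_lambda dir_flip a <= 1 ->
  psi alpha a.1 a.2 (diag alpha t) = diag alpha (M%:R * t - slope dir_lambda dir_flip a).
Proof.
have M0 : 0 < M%:R :> R by rewrite ltr0n (ltn_trans _ M2).
set t' := M%:R * t - _ => t'01.
have -> : diag alpha t = (Pi_diag alpha \o phi a.1 a.2) (diag alpha t').
  by rewrite Pi_phi_diag // /t' subrK mulrC mulKf ?gt_eqF.
rewrite /psi pinvKV //; last by rewrite inE; exists t' => //; rewrite /= in_itv.
move=> _ _ /set_mem[s + <-] /set_mem[s' + <-]; rewrite /= !in_itv /= => s01 s'01.
rewrite [X in X = _ -> _](Pi_phi_diag a s01) [X in _ = X -> _](Pi_phi_diag a s'01).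
by move=> /diag_inj/(divIf (lt0r_neq0 M0))/addIr ->.
Qed.

Lemma Pi_cell (a : D) (t : R) : (Pi_diag alpha @` cell R [:: a]) (diag alpha t) ->
  0 <= M%:R * t - slope dir_lambda dir_flip a <= 1.
Proof.
have M0 : 0 < M%:R :> R by rewrite ltr0n (ltn_trans _ M2).
move=> [z [z1 z2] zt].
pose w : R * R := (M%:R * z.1 - a.1%:R, M%:R * z.2 - a.2%:R).
have E : phi a.1 a.2 w = z.
  rewrite /phi /= [RHS]surjective_pairing; congr (_, _).
    by field; rewrite gt_eqF.
  by field; rewrite gt_eqF.
have unit01 (i : 'I_M) (x : R) : i%:R * M%:R ^- 1 <= x <= i%:R * M%:R ^- 1 + M%:R ^- 1 ->
    0 <= M%:R * x - i%:R <= 1.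
  rewrite expr1 -[X in _ + X]mul1r -mulrDl ler_pdivrMr // ler_pdivlMr //.
  by move=> /andP[? ?]; apply/andP; split; lra.
move: z1 z2; rewrite /corner /= !big_ord1 /= => /unit01 w1 /unit01 w2.
have [f1 f2] := @phi_unit a w w1 w2; rewrite E in f1 f2.
move: zt; rewrite Pi_diagE // => /diag_inj <-.
rewrite -E line_coord_phi mulrC divfK ?gt_eqF // addrK.
exact: line_coord01.
Qed.

Variable p : 'I_M -> 'I_M -> R.
Hypothesis p01 : forall i j, 0 <= p i j <= 1.

(** Iterating [F_op] unfolds into a sum over words. Dropping its restriction to the cells that
    project onto the point only adds nonnegative terms, which is the direction wanted, as Condition
    A bounds the iterate from below. *)
Lemma iter_F_op_le n (f : R * R -> R) t : (forall x, 0 <= f x) ->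
  iter n (F_op p alpha) f (diag alpha t) <=
  \sum_(w <- words D n) (\prod_(a <- w) p a.1 a.2) *
     f (diag alpha (zoom (slope dir_lambda dir_flip) w t)).
Proof.
move=> f0; have w0 (w : seq D) : 0 <= \prod_(a <- w) p a.1 a.2.
  by rewrite prodr_ge0 // => a _; have /andP[] := p01 a.1 a.2.
elim: n t => [|n IH] t; first by rewrite /= big_cons !big_nil addr0 mul1r.
rewrite iterS /F_op big_allpairs_dep /= big_enum /= big_mkcond /=.
apply: ler_sum => a _; case: ifP => [|_]; last first.
  by apply: sumr_ge0 => w _; rewrite mulr_ge0.
move=> /set_mem/Pi_cell tc; rewrite psi_diag //.
have /andP[pa0 _] := p01 a.1 a.2.
apply: (le_trans (ler_wpM2l pa0 (IH _))); rewrite mulr_sumr.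
by apply: ler_sum => w _; rewrite big_cons mulrA.
Qed.

Lemma condition_A_zoom : condition_A p alpha ->
  exists a1 b1 a2 b2 r, [/\ (0 < r)%N, 0 <= a2, a2 < a1, a1 < b1 & b1 < b2 /\ b2 <= 1] /\
  forall t, a2 <= t <= b2 -> 2 <= \sum_(w <- words D r |
    a1 <= zoom (slope dir_lambda dir_flip) w t <= b1) \prod_(a <- w) p a.1 a.2.
Proof.
move=> [a1 [b1 [a2 [b2 [r [[ab1 ab2 r0] [I12 I2 cond]]]]]]].
have mem_diag (a b t : R) : (diag alpha @` `]a, b[) (diag alpha t) -> a < t < b.
  by move=> [s + /diag_inj <-]; rewrite /= in_itv.
have mem_diag' (a b t : R) : a <= t <= b -> (diag alpha @` `[a, b]) (diag alpha t).
  by move=> tab; exists t => //; rewrite /= in_itv.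
have /andP[a21 a12] : a2 < a1 < b2.
  by apply/mem_diag/I12/mem_diag'; rewrite lexx ltW.
have /andP[a2b1 b12] : a2 < b1 < b2.
  by apply/mem_diag/I12/mem_diag'; rewrite lexx andbT ltW.
have /andP[a20 a2_1] : 0 < a2 < 1.
  by apply/mem_diag/I2/mem_diag'; rewrite lexx ltW.
have /andP[b20 b21] : 0 < b2 < 1.
  by apply/mem_diag/I2/mem_diag'; rewrite lexx andbT ltW.
exists a1, b1, a2, b2, r; split; first by split=> //; [exact: ltW|split=> //; exact: ltW].
move=> t tI; have /andP[t0 t1] : 0 < t < 1.
  by move/andP: tI => [? ?]; apply/andP; split; lra.
have /cond : Delta alpha (diag alpha t).
  by exists t => //; rewrite /= in_itv /= !ltW.
rewrite indicE mem_set ?mulr1; last exact: mem_diag'.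
move=> /le_trans; apply; apply: (le_trans (iter_F_op_le _ _ _)).
  by move=> x; rewrite indicE ler0n.
rewrite [leRHS]big_mkcond /=; apply: ler_sum => w _; rewrite indicE.
case: (boolP (_ \in _)) => [/set_mem[s + /diag_inj <-]|_].
  by rewrite /= in_itv /= mulr1 => ->.
rewrite mulr0; case: ifP => // _; rewrite prodr_ge0 // => a _.
by have /andP[] := p01 a.1 a.2.
Qed.

End DiagonalCoordinates.

(** * All directions *)

Lemma ae_forall_countable (d : measure_display) (T : measurableType d) (R : realType)
    (mu : {measure set T -> \bar R}) (C : countType) (Q : C -> T -> Prop) :
  (forall x, {ae mu, forall omega, Q x omega}) ->
  {ae mu, forall omega, forall x, Q x omega}.
Proof.
move=> aeQ; have := @ae_foralln _ _ _ mu
  (fun n omega => if unpickle n is Some x then Q x omega else True).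
case=> [n|N [mN N0 NQ]].
  case: unpickle => [x|]; first exact: aeQ.
  exact: aeW.
exists N; split=> // omega /= /existsNP[x nQ]; apply: NQ => /= all_n.
by have := all_n (pickle x); rewrite pickleK.
Qed.

Lemma contains_interval_line (R : realType) (T : Type) (M : nat)
    (A : word M * ('I_M * 'I_M) -> set T) omega (alpha lambda scale off : R) flip :
  scale != 0 ->
  (forall z : R * R, z.1 * cos alpha + z.2 * sin alpha =
     scale * line_coord lambda flip z + off) ->
  hits_interval A lambda flip omega ->
  contains_interval alpha (orth_proj alpha @` percolation_set R A omega).
Proof.
move=> s0 lin [a [b [ab hits]]].
have onto s : a <= (s - off) / scale <= b ->
    (orth_proj alpha @` percolation_set R A omega) (s * cos alpha, s * sin alpha).
  move=> /hits[z Ez zs]; exists z => //.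
  by rewrite /orth_proj lin zs mulrCA divff // mulr1 subrK.
have [sp|sn] : 0 < scale \/ scale < 0 by move: s0; rewrite neq_lt => /orP[]; [right|left].
  exists (scale * a + off), (scale * b + off); split; first by rewrite ltrD2r ltr_pM2l.
  move=> _ [s + <-]; rewrite /= in_itv /= => /andP[sa sb]; apply: onto.
  by rewrite ler_pdivlMr // ler_pdivrMr //; apply/andP; split; lra.
exists (scale * b + off), (scale * a + off); split; first by rewrite ltrD2r ltr_nM2l.
move=> _ [s + <-]; rewrite /= in_itv /= => /andP[sa sb]; apply: onto.
by rewrite ler_ndivlMr // ler_ndivrMr //; apply/andP; split; lra.
Qed.

Lemma ae_oblique (R : realType) (d : measure_display) (T : measurableType d)
    (P : probability T R) (M : nat) (p : 'I_M -> 'I_M -> R)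
    (A : word M * ('I_M * 'I_M) -> set T) : (2 <= M)%N ->
  (forall i j, 0 <= p i j <= 1) -> M%:R < \sum_(i < M) \sum_(j < M) p i j ->
  percolation_events P p A ->
  (forall alpha : R, alpha \in dirs R -> condition_A p alpha) ->
  {ae P, forall omega, percolation_set R A omega !=set0 ->
    forall alpha, dirs R alpha ->
      hits_interval A (dir_lambda alpha) (dir_flip alpha) omega}.
Proof.
move=> M2 p01 psum percoA condA.
(* The directions are covered by the countably many balls of parameters with
   rational centre and radius [1 / (n + 1)] on which the conclusion is almost sure. *)
pose near_good (x : rat * nat * bool) omega := percolation_set R A omega !=set0 ->
  forall lambda : R, 0 <= lambda <= 1 -> `|lambda - ratr x.1.1| <= x.1.2.+1%:R^-1 ->
    hits_interval A lambda x.2 omega.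
(* With almost sure goodness as a premise, the countable intersection can run over all balls without
   selecting the good ones, and its null set is fixed before [alpha]. *)
pose Q x omega := {ae P, forall omega, near_good x omega} -> near_good x omega.
have : {ae P, forall omega, forall x, Q x omega}.
  apply: ae_forall_countable => x.
  have [gx|ngx] := pselect ({ae P, forall omega, near_good x omega}).
    by move: (gx); apply: filterS => omega gxo _.
  by apply: aeW => omega /ngx.
apply: filterS => omega Qomega Eomega alpha dir_alpha.
have [_ l01] := dir_scale_neq0 dir_alpha.
have [a1 [b1 [a2 [b2 [r [[r0 a20 a21 ab1 [b12 b21]] cond]]]]]] :=
  condition_A_zoom M2 dir_alpha p01 (condA _ (mem_set dir_alpha)).
have [eta eta0 etaP] :=
  ae_generic M2 p01 psum percoA r0 a20 a21 ab1 b12 b21 cond.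
(* Half of [eta], so that a ball of this radius whose centre is as close to [dir_lambda alpha] fits
   in the ball given by [ae_generic]. *)
have [n nP] : exists n : nat, n.+1%:R^-1 <= eta / 2.
  exists (Num.truncn (2 / eta)); rewrite -[leRHS]invrK lef_pV2 ?posrE ?invr_gt0 ?divr_gt0 //.
  by rewrite invf_div ltW // truncnS_gt.
pose h : R := n.+1%:R^-1.
have h0 : 0 < h by rewrite invr_gt0 ltr0n.
have h1 : h <= eta / 2 by [].
have lt_ball : dir_lambda alpha - h < dir_lambda alpha + h by lra.
have [q] := rat_in_itvoo lt_ball; rewrite in_itv /= => /andP[q1 q2].
apply: (Qomega (q, n, dir_flip alpha)) => //=; last first.
  by rewrite -/h ler_norml; apply/andP; split; lra.
apply: filterS etaP => omega' H /H{}H lambda /= lambda01; rewrite -/h => lq.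
apply: H => //.
by move: lq; rewrite !ler_norml => /andP[? ?]; apply/andP; split; lra.
Qed.

(** Opposite directions span the same line: [e] is 1 or -1 according to the sign of [sin alpha]. *)
Lemma direction_half_turn (R : realType) (alpha : R) : exists beta e : R,
  [/\ 0 <= beta <= pi, e != 0, cos alpha = e * cos beta & sin alpha = e * sin beta].
Proof.
have sin_acos_cos (c : R) : cos alpha ^+ 2 = c ^+ 2 -> -1 <= c <= 1 ->
    sin (acos c) = `|sin alpha|.
  move=> cc c1; rewrite sin_acos // -cc -(cos2Dsin2 alpha) addrC addKr.
  exact: sqrtr_sqr.
have [s0|s0] := leP 0 (sin alpha).
  have c1 : -1 <= cos alpha <= 1 by rewrite cos_geN1 cos_le1.
  have [b0pi cb] := acos_def c1.
  exists (acos (cos alpha)), 1; split; rewrite ?oner_neq0 ?mul1r //.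
  by rewrite sin_acos_cos // ger0_norm.
have c1 : -1 <= - cos alpha <= 1 by rewrite lerN2 cos_le1 lerNl cos_geN1.
have [b0pi cb] := acos_def c1.
exists (acos (- cos alpha)), (-1); split; rewrite ?oppr_eq0 ?oner_neq0 ?mulN1r //.
  by rewrite cb opprK.
by rewrite sin_acos_cos ?sqrrN // ltr0_norm // opprK.
Qed.

Theorem theorem3 (R : realType) (d : measure_display) (T : measurableType d)
    (P : probability T R) (M : nat) (p : 'I_M -> 'I_M -> R)
    (A : word M * ('I_M * 'I_M) -> set T)
    (hM : (2 <= M)%N)
    (hp : forall i j, 0 <= p i j <= 1)
    (hsum : M%:R < \sum_(i < M) \sum_(j < M) p i j)
    (hA : percolation_events P p A)
    (hcond : forall alpha : R, alpha \in dirs R -> condition_A p alpha)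
    (hrow : forall i : 'I_M, 1 < \sum_(l < M) p i l)
    (hcol : forall j : 'I_M, 1 < \sum_(k < M) p k j) :
  {ae P, forall omega, percolation_set R A omega !=set0 ->
     forall alpha : R,
       contains_interval alpha (orth_proj alpha @` percolation_set R A omega)}.
Proof.
have ae_x : {ae P, forall omega, percolation_set R A omega !=set0 ->
    hits_interval A (1 : R) false omega}.
  (* For [lambda = 1] the lines are vertical, and the tests are the columns, with weights the sums
     of the [p i l] over [l]. *)
  apply: (ae_axis hM hp hsum hA (dg := fst)) => [|a|i]; first by rewrite ler01 lexx.
    by rewrite /slope subrr mul0r addr0 mul1r.
  apply: (lt_le_trans (hrow i)).
  rewrite [leRHS](_ : _ = \sum_(a : 'I_M * 'I_M | (a.1 == i) && true) p a.1 a.2); last first.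
    by apply: eq_bigl => a; rewrite andbT.
  by rewrite -(pair_big (fun k => k == i) xpredT (fun k l => p k l)) big_pred1_eq.
have ae_y : {ae P, forall omega, percolation_set R A omega !=set0 ->
    hits_interval A (0 : R) false omega}.
  apply: (ae_axis hM hp hsum hA (dg := snd)) => [|a|j]; first by rewrite ler01 lexx.
    by rewrite /slope subr0 mul0r add0r mul1r.
  apply: (lt_le_trans (hcol j)).
  rewrite -(pair_big xpredT (fun l => l == j) (fun k l => p k l)) /=.
  by apply: ler_sum => k _; rewrite big_pred1_eq.
have ae_o := ae_oblique hM hp hsum hA hcond.
move: ae_x ae_y ae_o; apply: filterS3 => omega ox oy oo E alpha.
have [beta [e [/andP[b0 bpi] e0 ca sa]]] := direction_half_turn alpha.
have reduce lambda flip (s off : R) : s != 0 ->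
    (forall z : R * R, z.1 * cos beta + z.2 * sin beta = s * line_coord lambda flip z + off) ->
    hits_interval A lambda flip omega ->
    contains_interval alpha (orth_proj alpha @` percolation_set R A omega).
  move=> s0 lin; apply: (@contains_interval_line _ _ _ _ _ _ _ (e * s) (e * off)).
    by rewrite mulf_neq0.
  move=> z; rewrite ca sa -mulrA -mulrDr -lin; ring.
have pi0 := pi_gt0 R.
(* In [0, pi], the directions 0 and pi use the columns and pi / 2 the rows; the others lie in
   [dirs R]. *)
have [bE|b_neq0] := eqVneq beta 0.
  apply: (reduce 1 false 1 0) (ox E); rewrite ?oner_neq0 // => z.
  by rewrite bE cos0 sin0 /line_coord; ring.
have [bE|b_neqpi] := eqVneq beta pi.
  apply: (reduce 1 false (-1) 0) (ox E); rewrite ?oppr_eq0 ?oner_neq0 // => z.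
  by rewrite bE cospi sinpi /line_coord; ring.
have [bE|b_neqpi2] := eqVneq beta (pi / 2).
  apply: (reduce 0 false 1 0) (oy E); rewrite ?oner_neq0 // => z.
  by rewrite bE cos_pihalf sin_pihalf /line_coord /flip_coord; ring.
have dir_beta : dirs R beta.
  have b0' : 0 < beta by rewrite lt_neqAle eq_sym b_neq0.
  have bpi' : beta < pi by rewrite lt_neqAle b_neqpi.
  by case: (ltgtP beta (pi / 2)) b_neqpi2 => // h _; [left|right];
    rewrite /= in_itv /= h ?b0' ?bpi'.
have [sc0 _] := dir_scale_neq0 dir_beta.
exact: (reduce _ _ _ _ sc0 (dir_line_coord dir_beta)) (oo E _ dir_beta).
Qed.
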